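(* Let $\Bbbk$ be an algebraically closed field (of arbitrary characteristic), let $H$ be an affine Hopf algebra over $\Bbbk$ and let $C$ be a central Hopf subalgebra of $H$ such that $H$ is a finitely generated $C$-module. Then for any $\mathfrak{m}\in\mathrm{maxSpec}\,C$, the Grothendieck group $\mathrm{Gr}(H/\mathfrak{m}H)$ is an irreducible $\mathbb{Z}_+$-module over the Grothendieck ring $\mathrm{Gr}(H/\mathfrak{m}_{\overline{\varepsilon}}H)$.
   Context: Affine means finitely generated as an algebra. For a finite-dimensional algebra $A$, $\mathrm{Gr}(A)$ is the Grothendieck group of the category of finite-dimensional left $A$-modules, free over $\mathbb{Z}$ with basis $\mathrm{Irr}(A)$, the set of isomorphism classes of irreducible $A$-modules. Let $\varepsilon$ be the counit of $H$, $\overline{\varepsilon}=\varepsilon|_C$, $\mathfrak{m}_{\overline{\varepsilon}}=\mathrm{Ker}\,\overline{\varepsilon}$. The coproduct of $H$ makes $H/\mathfrak{m}_{\overline{\varepsilon}}H$ a finite-dimensional Hopf algebra, so $\mathrm{Gr}(H/\mathfrak{m}_{\overline{\varepsilon}}H)$ is a ring under tensor product, and a $\mathbb{Z}_+$-ring with $\mathbb{Z}_+$-basis $\mathrm{Irr}(H/\mathfrak{m}_{\overline{\varepsilon}}H)$ (structure constants are non-negative integers). The coproduct also induces an algebra map $H/\mathfrak{m}H\to H/\mathfrak{m}_{\overline{\varepsilon}}H\otimes H/\mathfrak{m}H$, so that $[V][W]=[V\otimes W]$ makes $\mathrm{Gr}(H/\mathfrak{m}H)$ a module over $\mathrm{Gr}(H/\mathfrak{m}_{\overline{\varepsilon}}H)$.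 A $\mathbb{Z}_+$-module over a $\mathbb{Z}_+$-ring $(R,\{b_i\})$ is an $R$-module $M$ that is free over $\mathbb{Z}$ with a fixed basis $\{m_l\}_{l\in L}$ such that each $b_im_k$ is a non-negative integer combination of the $m_l$; here the fixed basis of $\mathrm{Gr}(H/\mathfrak{m}H)$ is $\mathrm{Irr}(H/\mathfrak{m}H)$. It is irreducible if whenever $J\subseteq L$ is such that the $\mathbb{Z}$-span of $\{m_l\}_{l\in J}$ is an $R$-submodule, then $J=\varnothing$ or $J=L$. *)

(* Defs.v *)
From HB Require Import structures.
From mathcomp Require Import all_boot all_order all_algebra.
From mathcomp Require Import freeg mxtens.
From mathcomp Require Import boolp classical_sets.

Set Implicit Arguments.
Unset Strict Implicit.
Unset Printing Implicit Defensive.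

Import GRing.Theory.
Local Open Scope ring_scope.
Local Open Scope quotient_scope.
Local Open Scope classical_set_scope.

Section QuotientModule.
Variables (R : nzRingType) (V : lmodType R) (S : set V).

(* The submodule generated by S, as a boolean predicate so that the quotient
   construction of ring_quotient applies. *)
Definition lin_span : {pred V} := fun x =>
  `[< exists2 s : seq (R * V),
        {in s, forall p, S p.2} & x = \sum_(p <- s) p.1 *: p.2 >].

Lemma lin_spanP x :
  reflect (exists2 s : seq (R * V),
             {in s, forall p, S p.2} & x = \sum_(p <- s) p.1 *: p.2)
          (x \in lin_span).
Proof. exact: asboolP. Qed.

Lemma lin_span_gen x : S x -> x \in lin_span.
Proof.
move=> Sx; apply/lin_spanP; exists [:: (1, x)].
  by move=> p; rewrite inE => /eqP ->.
by rewrite big_seq1 scale1r.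
Qed.

Lemma lin_span_submod_closed : submod_closed lin_span.
Proof.
split; first by apply/lin_spanP; exists [::] => //; rewrite big_nil.
move=> a x y /lin_spanP[s Ss ->] /lin_spanP[t St ->]; apply/lin_spanP.
exists ([seq (a * p.1, p.2) | p <- s] ++ t).
  move=> p; rewrite mem_cat => /orP[/mapP[q qs ->]|]; last exact: St.
  exact: Ss qs.
rewrite big_cat big_map scaler_sumr; congr (_ + _).
by apply: eq_bigr => p _; rewrite scalerA.
Qed.

HB.instance Definition _ :=
  GRing.isSubmodClosed.Build R V lin_span lin_span_submod_closed.

Lemma lin_span_min (P : V -> Prop) :
  P 0 -> (forall a x y, P x -> P y -> P (a *: x + y)) ->
  (forall x, S x -> P x) -> forall x, x \in lin_span -> P x.
Proof.
move=> P0 PL PS x /lin_spanP[s Ss ->].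
elim: s Ss => [|p s IHs] Ss; first by rewrite big_nil.
rewrite big_cons; apply: PL; first by apply/PS/Ss; rewrite inE eqxx.
by apply: IHs => q qs; apply: Ss; rewrite inE qs orbT.
Qed.

Definition quot_mod : Type := Quotient.quot lin_span.

HB.instance Definition _ := GRing.Zmodule.on quot_mod.
HB.instance Definition _ : EqQuotient V (Quotient.equiv lin_span) quot_mod :=
  EqQuotient.on quot_mod.

Definition qproj (x : V) : quot_mod := \pi_quot_mod x.

Lemma qproj_eq0 x : (qproj x == 0) = (x \in lin_span).
Proof.
rewrite -[x in RHS]subr0 Quotient.idealrBE.
by rewrite [\pi_(Quotient.quot lin_span) 0](raddf0 \pi_(Quotient.quot lin_span)).
Qed.

Definition quot_scale (a : R) (x : quot_mod) : quot_mod := qproj (a *: repr x).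

Lemma qprojB x y : qproj (x - y) = qproj x - qproj y.
Proof. exact: (raddfB \pi_(Quotient.quot lin_span)). Qed.

Lemma qprojD x y : qproj (x + y) = qproj x + qproj y.
Proof. exact: (raddfD \pi_(Quotient.quot lin_span)). Qed.

Lemma repr_qproj x : qproj (repr x) = x.
Proof. exact: reprK. Qed.

Lemma qproj_ind (P : quot_mod -> Prop) :
  (forall x, P (qproj x)) -> forall x, P x.
Proof. by move=> Pq x; rewrite -[x]repr_qproj. Qed.

Lemma quot_scaleE a x : quot_scale a (qproj x) = qproj (a *: x).
Proof.
apply/eqP; rewrite -subr_eq0 -qprojB qproj_eq0 -scalerBr rpredZ //.
by rewrite -qproj_eq0 qprojB repr_qproj subrr.
Qed.

Lemma quot_scaleA a b x : quot_scale a (quot_scale b x) = quot_scale (a * b) x.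
Proof. by elim/qproj_ind: x => x; rewrite !quot_scaleE scalerA. Qed.

Lemma quot_scale1 : left_id 1 quot_scale.
Proof. by elim/qproj_ind=> x; rewrite quot_scaleE scale1r. Qed.

Lemma quot_scaleDr : right_distributive quot_scale +%R.
Proof.
move=> a; elim/qproj_ind=> x; elim/qproj_ind=> y.
by rewrite -qprojD !quot_scaleE scalerDr qprojD.
Qed.

Lemma quot_scaleDl x : {morph quot_scale^~ x : a b / a + b}.
Proof.
by elim/qproj_ind: x => x a b; rewrite !quot_scaleE scalerDl qprojD.
Qed.

HB.instance Definition _ := GRing.Zmodule_isLmodule.Build R quot_mod
  quot_scaleA quot_scale1 quot_scaleDr quot_scaleDl.

Lemma qproj_is_linear : linear qproj.
Proof. by move=> a x y; rewrite qprojD -quot_scaleE. Qed.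

HB.instance Definition _ := GRing.isLinear.Build R V quot_mod _ qproj
  qproj_is_linear.

End QuotientModule.

Section FreeModule.
Variables (R : nzRingType) (K : choiceType).

Lemma freegU_scale (a c : R) (x : K) : << a * c *g x >> = a *: << c *g x >>.
Proof. by apply/eqP/freeg_eqP => z; rewrite coeffZ !coeffU mulrA. Qed.

Variables (U : lmodType R) (f : K -> U).

Lemma fglift_is_linear : linear (fglift f : {freeg K / R} -> U).
Proof.
have fgliftD D1 D2 : fglift f (D1 + D2) = fglift f D1 + fglift f D2.
  have fB := lift_is_additive f.
  have f0 : fglift f 0 = 0 by rewrite -(subrr 0) fB subrr.
  have fN D : fglift f (- D) = - fglift f D by rewrite -sub0r fB f0 sub0r.
  by rewrite -{1}[D2]opprK fB fN opprK.
move=> a D1 D2; rewrite fgliftD; congr (_ + _).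
have f0 : fglift f 0 = 0 by apply: (addrI (fglift f 0)); rewrite -fgliftD !addr0.
rewrite -[D1]freeg_sumE; elim: (dom D1) => [|x s IHs].
  by rewrite !big_nil scaler0 f0 scaler0.
rewrite !big_cons scalerDr !fgliftD IHs scalerDr; congr (_ + _).
by rewrite -freegU_scale !liftU scalerA.
Qed.

HB.instance Definition _ := GRing.isLinear.Build R {freeg K / R} U _
  (fglift f : {freeg K / R} -> U) fglift_is_linear.

End FreeModule.

Section FreeQuotient.
Variables (R : nzRingType) (K : choiceType) (S : set {freeg K / R}).
Variables (U : lmodType R) (f : K -> U).

Definition free_lift (x : quot_mod S) : U := fglift f (repr x).

Hypothesis fS : forall D, S D -> fglift f D = 0.

Lemma free_lift_qproj D : free_lift (qproj S D) = fglift f D.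
Proof.
apply/eqP; rewrite -subr_eq0 -raddfB.
set D' := _ - D; have : D' \in lin_span S.
  by rewrite -qproj_eq0 raddfB /= repr_qproj subrr.
elim/lin_span_min: (D') / => [||D0 /= /fS->//]; first by rewrite raddf0.
by move=> a D1 D2 /= /eqP E1 /eqP E2; rewrite linearP /= E1 E2 scaler0 addr0.
Qed.

Lemma free_lift_gen x : free_lift (qproj S << x >>) = f x.
Proof. by rewrite free_lift_qproj liftU scale1r. Qed.

Lemma free_lift_linear : linear free_lift.
Proof.
move=> a; elim/qproj_ind=> D1; elim/qproj_ind=> D2.
by rewrite -linearP !free_lift_qproj linearP.
Qed.

End FreeQuotient.

Lemma free_quot_ind (R : nzRingType) (K : choiceType) (S : set {freeg K / R})
    (P : quot_mod S -> Prop) :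
  P 0 -> (forall a x t, P t -> P (a *: qproj S << x >> + t)) -> forall t, P t.
Proof.
move=> P0 PD; apply: qproj_ind => D; rewrite -[D]freeg_sumE raddf_sum.
elim: (dom D) => [|x s IHs]; first by rewrite big_nil.
rewrite big_cons.
have -> : << coeff x D *g x >> = coeff x D *: << x >>.
  by rewrite -freegU_scale mulr1.
rewrite /= linearZ; exact: PD.
Qed.

Section TensorProduct.
Variables (k : fieldType) (V W : lmodType k).

(* The tensor product is the free k-module on V * W modulo bilinearity. *)
Definition tens_rel : set {freeg (V * W)%type / k} := fun D =>
  (exists a x x' y,
     D = << (a *: x + x', y) >> - (a *: << (x, y) >> + << (x', y) >>)) \/
  (exists a x y y',
     D = << (x, a *: y + y') >> - (a *: << (x, y) >> + << (x, y') >>)).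

Definition tens : Type := quot_mod tens_rel.
HB.instance Definition _ := GRing.Lmodule.on tens.

Definition pure (x : V) (y : W) : tens := qproj tens_rel << (x, y) >>.

Lemma pure_linearl y : linear (pure^~ y).
Proof.
move=> a x x'; rewrite /pure -linearP; apply/eqP.
rewrite -subr_eq0 -raddfB qproj_eq0.
by apply: lin_span_gen; left; exists a, x, x', y.
Qed.

Lemma pure_linearr x : linear (pure x).
Proof.
move=> a y y'; rewrite /pure -linearP; apply/eqP.
rewrite -subr_eq0 -raddfB qproj_eq0.
by apply: lin_span_gen; right; exists a, x, y, y'.
Qed.

Variables (U : lmodType k) (f : V -> W -> U).

(* The linear map induced by f; it takes the value f x y at pure x y when f is
   bilinear (tens_liftE), and is only meaningful in that case. *)
Definition tens_lift (t : tens) : U :=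
  free_lift (S := tens_rel) (fun p => f p.1 p.2) t.

Definition bilin := (forall y, linear (f^~ y)) /\ (forall x, linear (f x)).
Hypothesis bf : bilin.

Let f_rel D : tens_rel D -> fglift (fun p => f p.1 p.2) D = 0.
Proof.
by case=> [[a [x [x' [y ->]]]]|[a [x [y [y' ->]]]]];
  rewrite /= raddfB /= linearP /= !liftU !scale1r /= ?bf.1 ?bf.2 subrr.
Qed.

Lemma tens_liftE x y : tens_lift (pure x y) = f x y.
Proof. exact: free_lift_gen f_rel _. Qed.

Lemma tens_lift_linear : linear tens_lift.
Proof. exact: free_lift_linear f_rel. Qed.

End TensorProduct.
Arguments pure {k V W}.

Section LinearFacts.
Variables (k : fieldType).

Lemma lin_id (V : lmodType k) : linear (@id V).
Proof. by []. Qed.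

Lemma lin_comp (U V W : lmodType k) (g : V -> W) (f : U -> V) :
  linear g -> linear f -> linear (fun x => g (f x)).
Proof. by move=> lg lf a x y; rewrite lf lg. Qed.

Lemma lin0 (V W : lmodType k) (f : V -> W) : linear f -> f 0 = 0.
Proof. by move=> lf; have := lf (-1) 0 0; rewrite scaler0 addr0 scaleN1r addNr. Qed.

Lemma linZ (V W : lmodType k) (f : V -> W) : linear f ->
  forall a x, f (a *: x) = a *: f x.
Proof. by move=> lf a x; rewrite -[_ *: x]addr0 lf (lin0 lf) addr0. Qed.

Lemma linD (V W : lmodType k) (f : V -> W) : linear f ->
  forall x y, f (x + y) = f x + f y.
Proof. by move=> lf x y; rewrite -[x]scale1r lf !scale1r. Qed.

Lemma lin_sum (V W : lmodType k) (f : V -> W) : linear f ->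
  forall I (s : seq I) F, f (\sum_(i <- s) F i) = \sum_(i <- s) f (F i).
Proof.
move=> lf I s F; elim: s => [|i s IHs]; first by rewrite !big_nil (lin0 lf).
by rewrite !big_cons (linD lf) IHs.
Qed.

Lemma tens_ext (V W U : lmodType k) (f g : tens V W -> U) :
  linear f -> linear g -> (forall x y, f (pure x y) = g (pure x y)) -> f =1 g.
Proof.
move=> lf lg fg; apply: free_quot_ind => [|a [x y] t IHt].
  by rewrite (lin0 lf) (lin0 lg).
by rewrite lf lg IHt fg.
Qed.

End LinearFacts.

Definition tens_map (k : fieldType) (V W V' W' : lmodType k)
    (f : V -> V') (g : W -> W') : tens V W -> tens V' W' :=
  tens_lift (fun x y => pure (f x) (g y)).

Definition tens_assoc (k : fieldType) (U V W : lmodType k) :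
    tens (tens U V) W -> tens U (tens V W) :=
  tens_lift (fun t w => tens_lift (fun u v => pure u (pure v w)) t).

Definition tens_mul (k : fieldType) (A B : algType k) (t u : tens A B) :
    tens A B :=
  tens_lift (fun a b => tens_lift (fun a' b' => pure (a * a') (b * b')) u) t.

HB.mixin Record isHopfAlgebra (k : fieldType) H of GRing.Algebra k H := {
  comul : H -> tens H H;
  counit : H -> k;
  antipode : H -> H;
  comul_linear : linear comul;
  comul1 : comul 1 = pure 1 1;
  comulM : forall x y, comul (x * y) = tens_mul (comul x) (comul y);
  counit_linear : scalar counit;
  counit1 : counit 1 = 1;
  counitM : forall x y, counit (x * y) = counit x * counit y;
  antipode_linear : linear antipode;
  comulA : forall x,
    tens_assoc (tens_map comul id (comul x)) = tens_map id comul (comul x);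
  counitl : forall x, tens_lift (fun y z => counit y *: z) (comul x) = x;
  counitr : forall x, tens_lift (fun y z => counit z *: y) (comul x) = x;
  antipodel : forall x,
    tens_lift (fun y z => antipode y * z) (comul x) = counit x *: 1;
  antipoder : forall x,
    tens_lift (fun y z => y * antipode z) (comul x) = counit x *: 1
}.

#[short(type="hopfAlgType")]
HB.structure Definition HopfAlgebra (k : fieldType) :=
  {H of GRing.Algebra k H & isHopfAlgebra k H}.

Section HopfNotions.
Variables (k : fieldType) (H : hopfAlgType k).

Definition subalgebra (B : H -> Prop) :=
  [/\ B 1, forall (a : k) x y, B x -> B y -> B (a *: x + y)
    & forall x y, B x -> B y -> B (x * y)].

Definition affine := exists s : seq H, forall B : H -> Prop,
  subalgebra B -> {in s, forall x, B x} -> forall x, B x.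

(* The comultiplication condition says that comul c lies in the image of
   csub (x) csub, which over a field is csub (x) csub itself. *)
Record central_hopf_subalg := CentralHopfSubalg {
  csub :> H -> Prop;
  csub_subalg : subalgebra csub;
  csub_central : forall c, csub c -> forall h, c * h = h * c;
  csub_comul : forall c, csub c -> exists2 s : seq (H * H),
    {in s, forall p, csub p.1 /\ csub p.2}
    & comul c = \sum_(p <- s) pure p.1 p.2;
  csub_antipode : forall c, csub c -> csub (antipode c)
}.

Definition module_finite (C : central_hopf_subalg) :=
  exists n (e : 'I_n -> H), forall h, exists2 c : 'I_n -> H,
    forall i, C (c i) & h = \sum_i c i * e i.

Definition is_ideal (C J : H -> Prop) :=
  [/\ forall x, J x -> C x, J 0, forall x y, J x -> J y -> J (x + y)
    & forall c x, C c -> J x -> J (c * x)].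

Record maxSpec (C : central_hopf_subalg) := MaxSpec {
  mideal :> H -> Prop;
  mideal_ideal : is_ideal C mideal;
  mideal_proper : ~ mideal 1;
  mideal_max : forall J, is_ideal C J -> (forall x, mideal x -> J x) -> ~ J 1 ->
    forall x, J x -> mideal x
}.

Section Counit.
Variable C : central_hopf_subalg.

Definition counit_ker (x : H) := C x /\ counit x = 0.

Let counit0 : counit (0 : H) = 0.
Proof. by rewrite -[0 in LHS](subrr (1 : H)) -scaleN1r addrC counit_linear mulN1r addNr. Qed.

Let counitD (x y : H) : counit (x + y) = counit x + counit y.
Proof. by rewrite -[x]scale1r counit_linear mul1r scale1r. Qed.

Lemma csubL (a : k) x y : C x -> C y -> C (a *: x + y).
Proof. by have [_ CL _] := csub_subalg C; apply: CL. Qed.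

Lemma csub1 : C 1. Proof. by have [] := csub_subalg C. Qed.

Lemma csub0 : C 0.
Proof. by have := csubL (-1) csub1 csub1; rewrite scaleN1r addNr. Qed.

Lemma csubM x y : C x -> C y -> C (x * y).
Proof. by have [_ _] := csub_subalg C; apply. Qed.

Lemma counit_ker_ideal : is_ideal C counit_ker.
Proof.
split=> [x []//||x y [Cx x0] [Cy y0]|c x Cc [Cx x0]].
- by split; [exact: csub0 | exact: counit0].
- by split; [rewrite -[x]scale1r; exact: csubL | rewrite counitD x0 y0 addr0].
- by split; [exact: csubM | rewrite counitM x0 mulr0].
Qed.

Lemma counit_ker_proper : ~ counit_ker 1.
Proof. by case=> _ /eqP; rewrite counit1 oner_eq0. Qed.

Lemma counit_ker_max J : is_ideal C J -> (forall x, counit_ker x -> J x) ->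
  ~ J 1 -> forall x, J x -> counit_ker x.
Proof.
move=> [JC J0 JD JM] mJ J1 x Jx; split; first exact: JC.
apply/eqP/negPn/negP => ex0; apply: J1.
pose e := counit x; have Ce : C (e^-1 *: 1).
  by rewrite -[_ *: _]addr0; apply: csubL; [exact: csub1 | exact: csub0].
have Jd : J (- e^-1 *: x + 1).
  apply: mJ; split; first by apply: csubL; [exact: JC | exact: csub1].
  by rewrite counit_linear counit1 mulNr mulVf ?addNr.
have -> : 1 = (e^-1 *: 1) * x + (- e^-1 *: x + 1) :> H.
  by rewrite -scalerAl mul1r addrA scaleNr subrr add0r.
by apply: JD => //; exact: JM.
Qed.

Definition counit_max : maxSpec C :=
  MaxSpec counit_ker_ideal counit_ker_proper counit_ker_max.

End Counit.
End HopfNotions.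

(* Algebras over k that may be zero, given by their structure map: algType
   requires 1 != 0, which is not known a priori for the quotients below. *)
HB.mixin Record isKAlg (k : fieldType) A of GRing.PzRing A := {
  kmap : k -> A;
  kmap_zmod : zmod_morphism kmap;
  kmap_monoid : monoid_morphism kmap;
  kmap_central : forall a x, kmap a * x = x * kmap a
}.

#[short(type="kAlgType")]
HB.structure Definition KAlg (k : fieldType) := {A of GRing.PzRing A & isKAlg k A}.

Section Fiber.
Variables (k : fieldType) (H : hopfAlgType k) (C : central_hopf_subalg H).
Variable m : maxSpec C.

(* Its linear span is the product m H, a two-sided ideal since m is central. *)
Definition ideal_gen : set H := fun x => exists c h, m c /\ x = c * h.

Definition fiber : Type := quot_mod ideal_gen.
HB.instance Definition _ := GRing.Lmodule.on fiber.

Definition fproj (h : H) : fiber := qproj ideal_gen h.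

Lemma mideal_csub c : m c -> C c.
Proof. by have [+ _ _ _] := mideal_ideal m; apply. Qed.

Lemma ideal_mull a x : x \in lin_span ideal_gen -> a * x \in lin_span ideal_gen.
Proof.
elim/lin_span_min=> [|b y z|y [c [h [mc ->]]]]; first by rewrite mulr0 rpred0.
  by move=> Hy Hz; rewrite mulrDr -scalerAr rpredD ?rpredZ.
apply: lin_span_gen; exists c, (a * h); split=> //.
by rewrite mulrA -(csub_central (mideal_csub mc)) mulrA.
Qed.

Lemma ideal_mulr a x : x \in lin_span ideal_gen -> x * a \in lin_span ideal_gen.
Proof.
elim/lin_span_min=> [|b y z|y [c [h [mc ->]]]]; first by rewrite mul0r rpred0.
  by move=> Hy Hz; rewrite mulrDl -scalerAl rpredD ?rpredZ.
by apply: lin_span_gen; exists c, (h * a); split=> //; rewrite mulrA.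
Qed.

Definition fiber_mul (x y : fiber) : fiber :=
  fproj (repr (x : quot_mod ideal_gen) * repr (y : quot_mod ideal_gen)).

Lemma fproj_linear : linear fproj.
Proof. exact: qproj_is_linear. Qed.

Lemma fproj_eq x y : (fproj x == fproj y) = (x - y \in lin_span ideal_gen).
Proof. by rewrite -subr_eq0 -[fproj x - _]raddfB [LHS]qproj_eq0. Qed.

Lemma fiber_mulE x y : fiber_mul (fproj x) (fproj y) = fproj (x * y).
Proof.
rewrite /fiber_mul; set x' := repr _; set y' := repr _; apply/eqP.
have Ex : x' - x \in lin_span ideal_gen.
  by rewrite -fproj_eq /fproj repr_qproj.
have Ey : y' - y \in lin_span ideal_gen.
  by rewrite -fproj_eq /fproj repr_qproj.
rewrite fproj_eq; have -> : x' * y' - x * y = x' * (y' - y) + (x' - x) * y.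
  by rewrite mulrBr mulrBl addrA subrK.
by rewrite rpredD //; [exact: ideal_mull | exact: ideal_mulr].
Qed.

Lemma fproj_surj (x : fiber) : exists h, x = fproj h.
Proof. by exists (repr (x : quot_mod ideal_gen)); rewrite /fproj repr_qproj. Qed.

Fact fiber_mulA : associative fiber_mul.
Proof.
move=> x y z; have [{}x ->] := fproj_surj x; have [{}y ->] := fproj_surj y.
have [{}z ->] := fproj_surj z.
by rewrite !fiber_mulE mulrA.
Qed.

Fact fiber_mul1l : left_id (fproj 1) fiber_mul.
Proof. by move=> x; have [{}x ->] := fproj_surj x; rewrite fiber_mulE mul1r. Qed.

Fact fiber_mul1r : right_id (fproj 1) fiber_mul.
Proof. by move=> x; have [{}x ->] := fproj_surj x; rewrite fiber_mulE mulr1. Qed.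

Fact fiber_mulDl : left_distributive fiber_mul +%R.
Proof.
move=> x y z; have [{}x ->] := fproj_surj x; have [{}y ->] := fproj_surj y.
have [{}z ->] := fproj_surj z.
by rewrite -(linD fproj_linear) !fiber_mulE mulrDl (linD fproj_linear).
Qed.

Fact fiber_mulDr : right_distributive fiber_mul +%R.
Proof.
move=> x y z; have [{}x ->] := fproj_surj x; have [{}y ->] := fproj_surj y.
have [{}z ->] := fproj_surj z.
by rewrite -(linD fproj_linear) !fiber_mulE mulrDr (linD fproj_linear).
Qed.

HB.instance Definition _ := GRing.Zmodule_isPzRing.Build fiber
  fiber_mulA fiber_mul1l fiber_mul1r fiber_mulDl fiber_mulDr.

Lemma fprojM x y : fproj (x * y) = fproj x * fproj y.
Proof. by rewrite -fiber_mulE. Qed.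

Definition fiber_kmap (a : k) : fiber := fproj a%:A.

Fact fiber_kmap_zmod : zmod_morphism fiber_kmap.
Proof.
move=> a b; rewrite /fiber_kmap scalerBl -scaleN1r addrC fproj_linear.
by rewrite scaleN1r addrC.
Qed.

Fact fiber_kmap_monoid : monoid_morphism fiber_kmap.
Proof.
split=> [|a b]; first by rewrite /fiber_kmap scale1r.
by rewrite -fprojM -scalerAl mul1r scalerA.
Qed.

Fact fiber_kmap_central a x : fiber_kmap a * x = x * fiber_kmap a.
Proof.
have [{}x ->] := fproj_surj x.
by rewrite /fiber_kmap -!fprojM -scalerAl mul1r -scalerAr mulr1.
Qed.

HB.instance Definition _ := isKAlg.Build k fiber
  fiber_kmap_zmod fiber_kmap_monoid fiber_kmap_central.

End Fiber.

Section BilinearFacts.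
Variable k : fieldType.

Lemma pure_bilin (V W V' W' : lmodType k) (f : V -> V') (g : W -> W') :
  linear f -> linear g -> bilin (fun x y => pure (f x) (g y)).
Proof.
move=> lf lg; split=> [y|x] a u v; first by rewrite lf pure_linearl.
by rewrite lg pure_linearr.
Qed.

Lemma tens_map_linear (V W V' W' : lmodType k) (f : V -> V') (g : W -> W') :
  linear f -> linear g -> linear (tens_map f g).
Proof. by move=> lf lg; exact: tens_lift_linear (pure_bilin lf lg). Qed.

Lemma tens_mapE (V W V' W' : lmodType k) (f : V -> V') (g : W -> W') x y :
  linear f -> linear g -> tens_map f g (pure x y) = pure (f x) (g y).
Proof. by move=> lf lg; rewrite [LHS](tens_liftE (pure_bilin lf lg)). Qed.

Lemma mulr_linear (A : algType k) (a : A) : linear (fun x => a * x).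
Proof. by move=> c x y; rewrite mulrDr scalerAr. Qed.

Lemma mull_linear (A : algType k) (a : A) : linear (fun x => x * a).
Proof. by move=> c x y; rewrite mulrDl scalerAl. Qed.

Lemma mul_pure_bilin (A B : algType k) (a : A) (b : B) :
  bilin (fun a' b' => pure (a * a') (b * b')).
Proof. exact: pure_bilin (mulr_linear a) (mulr_linear b). Qed.

Lemma tens_mul_bilin (A B : algType k) (u : tens A B) :
  bilin (fun a b => tens_lift (fun a' b' => pure (a * a') (b * b')) u).
Proof.
have bf := @mul_pure_bilin A B.
split=> [b c a a'|a c b b'].
  apply: (tens_ext (f := fun u => tens_lift _ u)
    (g := fun u => c *: tens_lift _ u + tens_lift _ u)).
  - exact: tens_lift_linear.
  - by move=> d v w; rewrite !tens_lift_linear // !scalerDr !scalerA mulrC addrACA.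
  - by move=> x y; rewrite !tens_liftE // mull_linear pure_linearl.
apply: (tens_ext (f := fun u => tens_lift _ u)
  (g := fun u => c *: tens_lift _ u + tens_lift _ u)).
- exact: tens_lift_linear.
- by move=> d v w; rewrite !tens_lift_linear // !scalerDr !scalerA mulrC addrACA.
- by move=> x y; rewrite !tens_liftE // mull_linear pure_linearr.
Qed.

Lemma tens_mul_linearl (A B : algType k) (u : tens A B) :
  linear (fun t => tens_mul t u).
Proof. exact: tens_lift_linear (tens_mul_bilin u). Qed.

Lemma tens_mul_pure (A B : algType k) (a : A) (b : B) u :
  tens_mul (pure a b) u = tens_lift (fun a' b' => pure (a * a') (b * b')) u.
Proof. exact: tens_liftE (tens_mul_bilin u) _ _. Qed.

Lemma tens_mul_pure_linear (A B : algType k) (a : A) (b : B) :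
  linear (fun u => tens_mul (pure a b) u).
Proof.
move=> c u v; rewrite !tens_mul_pure tens_lift_linear //.
exact: mul_pure_bilin.
Qed.

Lemma tens_mul_pure2 (A B : algType k) (a a' : A) (b b' : B) :
  tens_mul (pure a b) (pure a' b') = pure (a * a') (b * b').
Proof.
by rewrite tens_mul_pure tens_liftE //; exact: mul_pure_bilin.
Qed.

End BilinearFacts.

Section Coaction.
Variables (k : fieldType) (H : hopfAlgType k) (C : central_hopf_subalg H).
Variable m : maxSpec C.

Definition proj_tens : tens H H -> tens (fiber (counit_max C)) (fiber m) :=
  tens_map (@fproj k H C (counit_max C)) (@fproj k H C m).

Lemma proj_tens_linear : linear proj_tens.
Proof. by apply: tens_map_linear; exact: fproj_linear. Qed.

Lemma proj_tens_pure x y : proj_tens (pure x y) = pure (fproj _ x) (fproj m y).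
Proof. by apply: tens_mapE; exact: fproj_linear. Qed.

(* The map H/mH -> H/m_eps H (x) H/mH induced by comul (see coactE); for
   m = m_eps it is the coproduct of H/m_eps H. *)
Definition coact (x : fiber m) : tens (fiber (counit_max C)) (fiber m) :=
  proj_tens (comul (repr (x : quot_mod (ideal_gen m)))).

Lemma counit0 : counit (0 : H) = 0.
Proof. by have := @counit_linear k H (-1) 0 0; rewrite scaler0 addr0 mulN1r addNr. Qed.

Lemma counitZ a (x : H) : counit (a *: x) = a * counit x.
Proof. by rewrite -[_ *: x]addr0 counit_linear counit0 addr0. Qed.

Lemma fproj_kill (n : maxSpec C) c h : n c -> fproj n (c * h) = 0.
Proof.
move=> nc; apply/eqP; rewrite -(lin0 (@fproj_linear k H C n)) fproj_eq subr0.
by apply: lin_span_gen; exists c, h.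
Qed.

Lemma fproj_counit c h : C c ->
  fproj (counit_max C) (c * h) = counit c *: fproj (counit_max C) h.
Proof.
move=> Cc; apply/eqP; rewrite -(linZ (@fproj_linear _ _ _ _)) fproj_eq.
have -> : c * h - counit c *: h = (c - counit c *: 1) * h.
  by rewrite mulrBl -scalerAl mul1r.
apply: lin_span_gen; exists (c - counit c *: 1), h; split=> //; split.
  by rewrite addrC -scaleNr; apply: csubL => //; exact: csub1.
by rewrite addrC -scaleNr counit_linear counit1 mulr1 addNr.
Qed.

Lemma proj_comul_kill z : z \in lin_span (ideal_gen m) -> proj_tens (comul z) = 0.
Proof.
have lL := lin_comp proj_tens_linear (@comul_linear k H).
elim/lin_span_min=> [|a v w Ev Ew|v [c [h [mc {v}->]]]]; first exact: lin0 lL.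
  by rewrite lL Ev Ew scaler0 addr0.
have Cc := mideal_csub mc; rewrite comulM.
have [s sC Es] := csub_comul Cc.
rewrite Es (lin_sum (tens_mul_linearl _)) (lin_sum proj_tens_linear).
have Ec : \sum_(p <- s) counit p.1 *: p.2 = c.
  rewrite -[RHS]counitl Es lin_sum; last first.
    apply: tens_lift_linear; split=> [y|y] a v w.
      by rewrite counit_linear scalerDl scalerA.
    by rewrite scalerDr !scalerA mulrC.
  apply: eq_bigr => p _; rewrite tens_liftE //; split=> [y|y] a v w.
    by rewrite counit_linear scalerDl scalerA.
  by rewrite scalerDr !scalerA mulrC.
move: (comul h) => u.
have E p : p \in s -> proj_tens (tens_mul (pure p.1 p.2) u) =
    tens_map (@fproj k H C (counit_max C)) (fun y => fproj m (counit p.1 *: p.2 * y)) u.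
  move=> ps; have lg : linear (fun y => fproj m (counit p.1 *: p.2 * y)).
    exact: lin_comp (@fproj_linear _ _ _ m) (mulr_linear _).
  apply: (tens_ext (f := fun u => proj_tens (tens_mul _ u))) => [|| x y].
  - exact: lin_comp proj_tens_linear (tens_mul_pure_linear _ _).
  - by apply: tens_map_linear => //; exact: fproj_linear.
  rewrite tens_mul_pure2 proj_tens_pure tens_mapE //; last exact: fproj_linear.
  rewrite fproj_counit; last by have [] := sC p ps.
  rewrite -scalerAl (linZ (@fproj_linear _ _ _ m)).
  by rewrite (linZ (pure_linearl _)) (linZ (pure_linearr _)).
rewrite big_seq (eq_bigr _ E) -big_seq.
pose g t := tens_map (@fproj k H C (counit_max C)) (fun y => fproj m (t * y)) u.
have lg (t : H) : linear (fun y => fproj m (t * y)).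
  exact: lin_comp (@fproj_linear _ _ _ m) (mulr_linear _).
have g_lin : linear g.
  move=> a t t'; rewrite /g.
  apply: (tens_ext (f := fun u => tens_map _ _ u)
    (g := fun u => a *: tens_map _ _ u + tens_map _ _ u)).
  - by apply: tens_map_linear => //; exact: fproj_linear.
  - move=> d v w; rewrite !tens_map_linear //; try exact: fproj_linear.
    by rewrite !scalerDr !scalerA mulrC addrACA.
  - move=> x y; rewrite !tens_mapE //; try exact: fproj_linear.
    by rewrite mull_linear fproj_linear pure_linearr.
rewrite -(lin_sum g_lin _ (fun p => counit p.1 *: p.2)) Ec /g.
apply: (tens_ext (f := fun u => tens_map _ _ u) (g := fun _ => 0)) => [||x y].
- by apply: tens_map_linear => //; exact: fproj_linear.
- by move=> a v w; rewrite scaler0 addr0.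
rewrite tens_mapE //; last exact: fproj_linear.
by rewrite fproj_kill // (lin0 (pure_linearr _)).
Qed.

Lemma coactE h : coact (fproj m h) = proj_tens (comul h).
Proof.
have lL := lin_comp proj_tens_linear (@comul_linear k H).
apply/eqP; rewrite -subr_eq0 /coact -scaleN1r addrC -lL; apply/eqP.
apply: proj_comul_kill; rewrite addrC scaleN1r -fproj_eq.
by rewrite /fproj repr_qproj.
Qed.

End Coaction.

Section FinDimModules.
Variables (k : fieldType) (A : kAlgType k).

(* A finite-dimensional left module, up to the choice of a basis: the column
   space k^n on which x acts by left multiplication by the matrix fdact x. *)
Record fdmod := FdMod {
  fddim : nat;
  fdact : A -> 'M[k]_fddim;
  fdact_zmod : zmod_morphism fdact;
  fdact_monoid : monoid_morphism fdact;
  fdact_kmap : forall a, fdact (kmap a) = a%:M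
}.

HB.instance Definition _ := gen_eqMixin fdmod.
HB.instance Definition _ := gen_choiceMixin fdmod.

Implicit Types U V W : fdmod.

Definition fdhom U V (f : 'M[k]_(fddim V, fddim U)) :=
  forall x, f *m fdact U x = fdact V x *m f.

Definition fdiso U V := exists (f : 'M_(fddim V, fddim U)) g,
  [/\ fdhom f, f *m g = 1%:M & g *m f = 1%:M].

Definition short_exact U V W := exists (f : 'M_(fddim V, fddim U))
    (g : 'M_(fddim W, fddim V)),
  [/\ fdhom f /\ fdhom g,
      injective (fun u : 'cV_(fddim U) => f *m u),
      forall w : 'cV_(fddim W), exists v, w = g *m v
    & forall v : 'cV_(fddim V), g *m v = 0 <-> exists u, v = f *m u].

Definition fdirr V := (0 < fddim V)%N /\
  forall X : {vspace 'cV[k]_(fddim V)},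
    (forall x, {in X, forall v, fdact V x *m v \in X}) ->
    X = 0%VS \/ X = fullv.

Lemma fdiso_refl V : fdiso V V.
Proof. by exists 1%:M, 1%:M; split; rewrite ?mulmx1 // => x; rewrite mul1mx mulmx1. Qed.

Lemma fdiso_sym U V : fdiso U V -> fdiso V U.
Proof.
move=> [f [g [hf fg gf]]]; exists g, f; split=> // x.
by rewrite -[LHS]mulmx1 -fg !mulmxA -[g *m _ *m f]mulmxA -hf mulmxA gf mul1mx.
Qed.

Lemma fdiso_trans V U W : fdiso U V -> fdiso V W -> fdiso U W.
Proof.
move=> [f [g [hf fg gf]]] [f' [g' [hf' fg' gf']]].
exists (f' *m f), (g *m g'); split=> [x||].
- by rewrite -mulmxA hf mulmxA hf' mulmxA.
- by rewrite mulmxA -(mulmxA f') fg mulmx1.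
- by rewrite mulmxA -(mulmxA g) gf' mulmx1.
Qed.

(* Irr is the set of isomorphism classes of irreducible modules. *)
Definition irr_mod := {V : fdmod | `[< fdirr V >]}.

Definition irr_iso : rel irr_mod := fun s t => `[< fdiso (val s) (val t) >].

Lemma irr_iso_equiv : equiv_class_of irr_iso.
Proof.
split=> [V|V W|V U W]; first by apply/asboolP/fdiso_refl.
  by apply/asboolP/asboolP; exact: fdiso_sym.
move=> /asboolP UV /asboolP VW; apply/asboolP; exact: fdiso_trans UV VW.
Qed.

Canonical irr_iso_equivRel := EquivRelPack irr_iso_equiv.

Definition Irr : Type := {eq_quot irr_iso}.
HB.instance Definition _ := Choice.on Irr.

(* The Grothendieck group: free abelian group on the finite-dimensional modules
   modulo [V] = [U] + [W] for each exact 0 -> U -> V -> W -> 0. *)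
Definition gr_rel : set {freeg fdmod / int} := fun D => exists U V W,
  short_exact U V W /\ D = << V >> - (<< U >> + << W >>).

Definition Gr : Type := quot_mod gr_rel.
HB.instance Definition _ := GRing.Zmodule.on Gr.

Definition gr_class V : Gr := qproj gr_rel << V >>.

Definition irr_class (l : Irr) : Gr := gr_class (val (repr (l : {eq_quot irr_iso}))).

End FinDimModules.

Section Kronecker.
Variable k : fieldType.

Lemma tensmx_bilin m n p q :
  bilin (fun (A : 'M[k]_(m, n)) (B : 'M[k]_(p, q)) => A *t B).
Proof.
split=> [B a A A'|A a B B']; apply/matrixP => i j; rewrite !mxE.
  by rewrite mulrDl mulrA.
by rewrite mulrDr mulrCA.
Qed.

Lemma tens1mx1 m n : 1%:M *t 1%:M = 1%:M :> 'M[k]_(m * n).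
Proof.
apply/matrixP => i j; case: (mxtens_indexP i) => i1 i2.
case: (mxtens_indexP j) => j1 j2; rewrite tensmxE !mxE -natrM mulnb.
congr (nat_of_bool _)%:R; rewrite (can_eq (@mxtens_indexK _ _)).
by rewrite xpair_eqE.
Qed.

Lemma tensmxA m n p q r s
    (A : 'M[k]_(m, n)) (B : 'M[k]_(p, q)) (D : 'M[k]_(r, s)) :
  A *t (B *t D) = castmx (esym (mulnA m p r), esym (mulnA n q s)) (A *t B *t D).
Proof.
have idx a b c (i1 : 'I_a) (i2 : 'I_b) (i3 : 'I_c) :
    cast_ord (mulnA a b c) (mxtens_index (i1, mxtens_index (i2, i3))) =
    mxtens_index (mxtens_index (i1, i2), i3).
  by apply: val_inj; rewrite /= mulnDl -mulnA addnA.
apply/matrixP => i j; rewrite castmxE !esymK.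
case: (mxtens_indexP i) => i1 i'; case: (mxtens_indexP i') => i2 i3.
case: (mxtens_indexP j) => j1 j'; case: (mxtens_indexP j') => j2 j3.
by rewrite !idx !tensmxE mulrA.
Qed.

End Kronecker.

Section ExactFacts.
Variables (k : fieldType) (A : kAlgType k).
Implicit Types U V W : fdmod A.

Lemma short_exact_split U V W : short_exact U V W ->
  exists (f : 'M_(fddim V, fddim U)) (g : 'M_(fddim W, fddim V)) t s,
  [/\ fdhom f /\ fdhom g, g *m f = 0, t *m f = 1%:M, g *m s = 1%:M
    & f *m t + s *m g = 1%:M].
Proof.
move=> [f [g [hom finj gsurj ex]]].
have injm n (M N : 'M_(_, n)) : f *m M = f *m N -> M = N.
  move=> E; apply/matrixP => i j.
  have : col j M = col j N by apply: finj; rewrite !colE !mulmxA E.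
  by move/matrixP/(_ i ord0); rewrite !mxE.
have im n (M : 'M_(_, n)) : g *m M = 0 -> exists N, M = f *m N.
  move=> E; have /= H j : exists u, col j M = f *m u.
    by apply/ex; rewrite colE mulmxA E mul0mx.
  have [u Hu] := choice H; exists (\matrix_(i, j) u j i ord0).
  apply/matrixP => i j; have := Hu j; move/matrixP/(_ i ord0).
  by rewrite !mxE => ->; apply: eq_bigr => l _; rewrite mxE.
have gf0 : g *m f = 0.
  apply/matrixP => i j; have : g *m (f *m delta_mx j ord0) = 0 :> 'cV_ _.
    by apply/ex; exists (delta_mx j ord0).
  by rewrite mulmxA -colE => /matrixP/(_ i ord0); rewrite !mxE.
have [s gs] : exists s, g *m s = 1%:M.
  have /= H (j : 'I_(fddim W)) : exists u : 'cV_ _, col j 1%:M = g *m u by apply: gsurj.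
  have [u Hu] := choice H; exists (\matrix_(i, j) u j i ord0).
  apply/matrixP => i j; have := Hu j; move/matrixP/(_ i ord0).
  by rewrite !mxE => ->; apply: eq_bigr => l _; rewrite mxE.
have [t ft] : exists t, 1%:M - s *m g = f *m t.
  by apply: im; rewrite mulmxBr mulmx1 mulmxA gs mul1mx subrr.
exists f, g, t, s; split=> //; last by rewrite -ft subrK.
by apply: injm; rewrite mulmxA -ft mulmxBl mul1mx -mulmxA gf0 mulmx0 subr0 mulmx1.
Qed.

Lemma split_short_exact U V W (f : 'M_(fddim V, fddim U))
    (g : 'M_(fddim W, fddim V)) t s :
  fdhom f -> fdhom g -> g *m f = 0 -> t *m f = 1%:M -> g *m s = 1%:M ->
  f *m t + s *m g = 1%:M -> short_exact U V W.
Proof.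
move=> hf hg gf tf gs fs; exists f, g; split=> //.
- by move=> u v /(congr1 (mulmx t)); rewrite !mulmxA tf !mul1mx.
- by move=> w; exists (s *m w); rewrite mulmxA gs mul1mx.
move=> v; split=> [gv|[u ->]]; last by rewrite mulmxA gf mul0mx.
exists (t *m v); rewrite -[LHS]mul1mx -fs mulmxDl -!mulmxA gv mulmx0 addr0.
by [].
Qed.

Lemma gr_class_exact U V W : short_exact U V W ->
  gr_class V = gr_class U + gr_class W.
Proof.
move=> E; apply/eqP; rewrite -subr_eq0.
have -> : gr_class V - (gr_class U + gr_class W) =
    qproj (@gr_rel k A) (<< V >> - (<< U >> + << W >>)).
  by rewrite qprojB qprojD.
apply: (etrans (qproj_eq0 (@gr_rel k A) _)).
by apply: lin_span_gen; exists U, V, W.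
Qed.

Lemma fd0_zmod : zmod_morphism (fun _ : A => 0 : 'M[k]_0).
Proof. by move=> x y; rewrite subr0. Qed.

Lemma fd0_monoid : monoid_morphism (fun _ : A => 0 : 'M[k]_0).
Proof. by split=> [|x y]; apply/matrixP => -[]. Qed.

Lemma fd0_kmap (a : k) : 0 = a%:M :> 'M[k]_0.
Proof. by apply/matrixP => -[]. Qed.

Definition fd0 : fdmod A := FdMod fd0_zmod fd0_monoid fd0_kmap.

Lemma gr_class0 : gr_class fd0 = 0.
Proof.
have E : short_exact fd0 fd0 fd0.
  by apply: (@split_short_exact fd0 fd0 fd0 0 0 0 0);
    try (move=> x); apply/matrixP => -[].
by apply: (addrI (gr_class fd0)); rewrite addr0 -(gr_class_exact E).
Qed.

Lemma gr_class_iso V W : fdiso V W -> gr_class V = gr_class W.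
Proof.
move=> [f [g [hf fg gf]]]; rewrite -[RHS]addr0 -gr_class0.
rewrite addrC; apply: gr_class_exact.
apply: (@split_short_exact fd0 V W 0 f 0 g) => //.
- by move=> x; apply/matrixP => i [].
- by rewrite mulmx0.
- by apply/matrixP => -[].
- by rewrite mul0mx add0r.
Qed.

Lemma cast_fdiso V W (e : fddim V = fddim W) :
  (forall x, fdact W x = castmx (e, e) (fdact V x)) -> fdiso V W.
Proof.
case: V W e => n aV zV mV kV [n' aW zW mW kW] /= e; move: e aW zW mW kW.
case: _ / => aW zW mW kW E; exists 1%:M, 1%:M; split; rewrite ?mulmx1 // => x.
by rewrite /= E castmx_id mul1mx mulmx1.
Qed.

End ExactFacts.

Section GrLift.
Variables (k : fieldType) (A : kAlgType k) (U : lmodType int).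
Variable f : fdmod A -> U.
Hypothesis fex : forall V1 V2 V3, short_exact V1 V2 V3 -> f V2 = f V1 + f V3.

Lemma gr_rel_lift D : gr_rel D -> fglift f D = 0.
Proof.
move=> [V1 [V2 [V3 [E ->]]]]; rewrite raddfB raddfD /= !liftU !scale1r (fex E).
exact: subrr.
Qed.

Lemma gr_lift_class V : free_lift (S := @gr_rel k A) f (gr_class V) = f V.
Proof. exact: free_lift_gen gr_rel_lift _. Qed.

Lemma gr_lift_linear : linear (free_lift (S := @gr_rel k A) f).
Proof. exact: free_lift_linear gr_rel_lift. Qed.

End GrLift.

Section GrInd.
Variables (k : fieldType) (A : kAlgType k).

Lemma gr_ext (G : zmodType) (f g : Gr A -> G) :
  {morph f : x y / x + y} -> {morph g : x y / x + y} ->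
  (forall V, f (gr_class V) = g (gr_class V)) -> f =1 g.
Proof.
move=> fD gD fg.
have m0 (h : Gr A -> G) : {morph h : x y / x + y} -> h 0 = 0 :> G.
  by move=> hD; apply: (addrI (h 0)); rewrite -hD !addr0.
have mN (h : Gr A -> G) : {morph h : x y / x + y} -> forall x, h (- x) = - h x.
  by move=> hD x; apply: (addrI (h x)); rewrite -hD !subrr (m0 _ hD).
have mZ (h : Gr A -> G) : {morph h : x y / x + y} ->
    forall (z : int) (x : quot_mod (@gr_rel k A)), h (z *: x) = h x *~ z.
  move=> hD z x; have hn n : h (x *+ n) = h x *+ n.
    by elim: n => [|n IHn]; rewrite ?mulr0n ?(m0 _ hD) // !mulrS hD IHn.
  have -> : z *: x = x *~ z by rewrite -[z in LHS]intz scaler_int.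
  by case: z => n; rewrite ?NegzE ?mulrNz ?(mN _ hD) // -?pmulrn hn.
apply: free_quot_ind => [|z V t IHt]; first by rewrite (m0 _ fD) (m0 _ gD).
by rewrite fD gD IHt (mZ _ fD) (mZ _ gD) [f (qproj _ _)]fg.
Qed.

End GrInd.

Section TensorModules.
Variables (k : fieldType) (H : hopfAlgType k) (C : central_hopf_subalg H).

Lemma fdact_linear (n : maxSpec C) (V : fdmod (fiber n)) : linear (fdact V).
Proof.
move=> a x y; have [x' Ex] := fproj_surj x.
have -> : a *: x = kmap a * x.
  by rewrite Ex -[kmap a]/(fproj n a%:A) -fprojM -scalerAl mul1r
    (linZ (@fproj_linear _ _ _ n)).
have D u v : fdact V (u + v) = fdact V u + fdact V v.
  have B := fdact_zmod V; have B0 : fdact V 0 = 0 by rewrite -(subrr 0) B subrr.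
  by have := B u (0 - v); rewrite (B 0) B0 !sub0r !opprK.
have [_ M] := fdact_monoid V.
by rewrite D M fdact_kmap -mul_scalar_mx.
Qed.

Variable m : maxSpec C.

Section Action.
Variables (V : fdmod (fiber (counit_max C))) (W : fdmod (fiber m)).

(* The action of H/mH on V (x) W through coact; a (x) b acts by the Kronecker
   product of the matrices of a and b. *)
Definition tens_act (x : fiber m) : 'M[k]_(fddim V * fddim W) :=
  tens_lift (fun a b => fdact V a *t fdact W b) (coact x).

Let act2 (t : tens H H) : 'M[k]_(fddim V * fddim W) :=
  tens_lift (fun x y => fdact V (fproj _ x) *t fdact W (fproj _ y)) t.

Let act_bilin : bilin (fun a b => fdact V a *t fdact W b).
Proof.
have [tl tr] := tensmx_bilin k (fddim V) (fddim V) (fddim W) (fddim W).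
by split=> [b|a] c u v; rewrite fdact_linear (tl, tr).
Qed.

Lemma hact_bilin :
  bilin (fun x y : H => fdact V (fproj _ x) *t fdact W (fproj _ y)).
Proof.
have [tl tr] := tensmx_bilin k (fddim V) (fddim V) (fddim W) (fddim W).
by split=> [b|a] c u v; rewrite fproj_linear fdact_linear (tl, tr).
Qed.

Let act2_linear : linear act2. Proof. exact: tens_lift_linear hact_bilin. Qed.

Lemma tens_actE h : tens_act (fproj m h) =
  tens_lift (fun x y => fdact V (fproj _ x) *t fdact W (fproj _ y)) (comul h).
Proof.
rewrite /tens_act coactE; move: (comul h).
apply: (tens_ext (f := fun t => tens_lift _ (proj_tens m t))) => [||x y].
- exact: lin_comp (tens_lift_linear act_bilin) (@proj_tens_linear _ _ _ m).
- exact: act2_linear.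
by rewrite proj_tens_pure !tens_liftE //; exact: hact_bilin.
Qed.

Let act2M t u : act2 (tens_mul t u) = act2 t *m act2 u.
Proof.
have mxl n (M : 'M[k]_n) : linear (fun N : 'M_n => M *m N).
  by move=> a x y; rewrite mulmxDr scalemxAr.
have mxr n (M : 'M[k]_n) : linear (fun N : 'M_n => N *m M).
  by move=> a x y; rewrite mulmxDl scalemxAl.
move: t; apply: (tens_ext (f := fun t => act2 (tens_mul t u))
  (g := fun t => act2 t *m act2 u)) => [||x y].
- exact: lin_comp act2_linear (tens_mul_linearl u).
- exact: lin_comp (mxr _ _) act2_linear.
move: u; apply: (tens_ext (f := fun u => act2 (tens_mul _ u))
  (g := fun u => act2 _ *m act2 u)) => [||x' y'].
- exact: lin_comp act2_linear (tens_mul_pure_linear _ _).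
- exact: lin_comp (mxl _ _) act2_linear.
rewrite tens_mul_pure2 /act2 !(tens_liftE hact_bilin) tensmx_mul !fprojM.
by rewrite (fdact_monoid V).2 (fdact_monoid W).2.
Qed.

Fact tens_act_zmod : zmod_morphism tens_act.
Proof.
move=> x y; have [{}x ->] := fproj_surj x; have [{}y ->] := fproj_surj y.
rewrite -scaleN1r addrC -fproj_linear !tens_actE comul_linear.
by rewrite [LHS]act2_linear scaleN1r addrC.
Qed.

Fact tens_act_monoid : monoid_morphism tens_act.
Proof.
split=> [|x y].
  rewrite -[1]/(fproj m 1) tens_actE comul1 (tens_liftE hact_bilin).
  by rewrite (fdact_monoid V).1 (fdact_monoid W).1 tens1mx1.
have [{}x ->] := fproj_surj x; have [{}y ->] := fproj_surj y.
by rewrite -fprojM !tens_actE comulM [LHS]act2M.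
Qed.

Fact tens_act_kmap a : tens_act (kmap a) = a%:M.
Proof.
rewrite -[kmap a]/(fproj m a%:A) tens_actE (linZ (@comul_linear _ H)).
rewrite [LHS](linZ act2_linear) comul1 /act2 (tens_liftE hact_bilin).
by rewrite (fdact_monoid V).1 (fdact_monoid W).1 tens1mx1 scalemx1.
Qed.

Definition tens_mod : fdmod (fiber m) :=
  FdMod tens_act_zmod tens_act_monoid tens_act_kmap.

End Action.

Lemma tensmx_hom V V' W W' (f : 'M_(fddim V', fddim V)) (g : 'M_(fddim W', fddim W)) :
  fdhom f -> fdhom g -> @fdhom _ _ (tens_mod V W) (tens_mod V' W') (f *t g).
Proof.
move=> hf hg x; have [{}x ->] := fproj_surj x; rewrite /= !tens_actE.
have mxl p q r (M : 'M[k]_(p, q)) : linear (fun N : 'M_(q, r) => M *m N).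
  by move=> a u v; rewrite mulmxDr scalemxAr.
have mxr p q r (M : 'M[k]_(p, q)) : linear (fun N : 'M_(r, p) => N *m M).
  by move=> a u v; rewrite mulmxDl scalemxAl.
move: (comul x); apply: (tens_ext (f := fun t => _ *m tens_lift _ t)
  (g := fun t => tens_lift _ t *m _)) => [||u v].
- exact: lin_comp (mxl _ _ _ _) (tens_lift_linear (hact_bilin V W)).
- exact: lin_comp (mxr _ _ _ _) (tens_lift_linear (hact_bilin V' W')).
rewrite (tens_liftE (hact_bilin V W)) (tens_liftE (hact_bilin V' W')).
by rewrite !tensmx_mul hf hg.
Qed.

Lemma hom1 (A : kAlgType k) (V : fdmod A) : @fdhom _ _ V V 1%:M.
Proof. by move=> x; rewrite mul1mx mulmx1. Qed.

Lemma tens_mod_exactl V1 V2 V3 W :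
  short_exact V1 V2 V3 ->
  short_exact (tens_mod V1 W) (tens_mod V2 W) (tens_mod V3 W).
Proof.
move=> /short_exact_split[f [g [t [s [[hf hg] gf tf gs fs]]]]].
have [tl _] := tensmx_bilin k (fddim V2) (fddim V2) (fddim W) (fddim W).
apply: (@split_short_exact _ _ (tens_mod V1 W) (tens_mod V2 W) (tens_mod V3 W)
  (f *t 1%:M) (g *t 1%:M) (t *t 1%:M) (s *t 1%:M)).
- exact: tensmx_hom hf (hom1 _).
- exact: tensmx_hom hg (hom1 _).
- by rewrite tensmx_mul gf tens0mx.
- by rewrite tensmx_mul tf mul1mx tens1mx1.
- by rewrite tensmx_mul gs mul1mx tens1mx1.
- by rewrite !tensmx_mul !mul1mx -(linD (tl _)) fs tens1mx1.
Qed.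

Lemma tens_mod_exactr V W1 W2 W3 :
  short_exact W1 W2 W3 ->
  short_exact (tens_mod V W1) (tens_mod V W2) (tens_mod V W3).
Proof.
move=> /short_exact_split[f [g [t [s [[hf hg] gf tf gs fs]]]]].
have [_ tr] := tensmx_bilin k (fddim V) (fddim V) (fddim W2) (fddim W2).
apply: (@split_short_exact _ _ (tens_mod V W1) (tens_mod V W2) (tens_mod V W3)
  (1%:M *t f) (1%:M *t g) (1%:M *t t) (1%:M *t s)).
- exact: tensmx_hom (hom1 _) hf.
- exact: tensmx_hom (hom1 _) hg.
- by rewrite tensmx_mul gf tensmx0.
- by rewrite tensmx_mul tf mul1mx tens1mx1.
- by rewrite tensmx_mul gs mul1mx tens1mx1.
- by rewrite !tensmx_mul !mul1mx -(linD (tr _)) fs tens1mx1.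
Qed.

(* The biadditive map with [V] [W] = [V (x) W] (gr_mulE). *)
Definition gr_mul (x : Gr (fiber (counit_max C))) (y : Gr (fiber m)) :
    Gr (fiber m) :=
  free_lift (S := @gr_rel k (fiber (counit_max C))) (U := quot_mod (@gr_rel k (fiber m)))
    (fun V => free_lift (S := @gr_rel k (fiber m)) (U := quot_mod (@gr_rel k (fiber m)))
                (fun W => gr_class (tens_mod V W)) y) x.

End TensorModules.

Lemma castmx_linear (k : fieldType) m n m' n' (e1 : m = m') (e2 : n = n') :
  linear (castmx (e1, e2) : 'M[k]_(m, n) -> 'M[k]_(m', n')).
Proof. by case: _ / e1; case: _ / e2 => a u v; rewrite !castmx_id. Qed.

Section GrMul.
Variables (k : fieldType) (H : hopfAlgType k) (C : central_hopf_subalg H).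
Variable m : maxSpec C.

Let T (V : fdmod (fiber (counit_max C))) (y : Gr (fiber m)) : Gr (fiber m) :=
  free_lift (S := @gr_rel k (fiber m)) (U := quot_mod (@gr_rel k (fiber m)))
    (fun W => gr_class (tens_mod V W)) y.

Let T_ex V W1 W2 W3 : short_exact W1 W2 W3 ->
  gr_class (@tens_mod k H C m V W2) =
  gr_class (tens_mod V W1) + gr_class (tens_mod V W3).
Proof. by move=> E; apply: gr_class_exact; exact: tens_mod_exactr. Qed.

Let T_class V W : T V (gr_class W) = gr_class (tens_mod V W).
Proof. exact: (gr_lift_class (@T_ex V)). Qed.

Let TD V : {morph T V : x y / x + y}.
Proof.
move=> x y; have L := gr_lift_linear (@T_ex V).
by have := L 1 x y; rewrite !scale1r.
Qed.

Let mul_ex y V1 V2 V3 : short_exact V1 V2 V3 -> T V2 y = T V1 y + T V3 y.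
Proof.
move=> E; move: y; apply: (gr_ext (f := T V2) (g := fun y => T V1 y + T V3 y)).
- exact: TD.
- by move=> x y; rewrite !TD addrACA.
- by move=> W; rewrite !T_class; apply: gr_class_exact; exact: tens_mod_exactl.
Qed.

Lemma gr_mulDl (x x' : Gr (fiber (counit_max C))) (y : Gr (fiber m)) :
  gr_mul (x + x') y = gr_mul x y + gr_mul x' y.
Proof.
have L := gr_lift_linear (U := quot_mod (@gr_rel k (fiber m))) (@mul_ex y).
by have := L 1 x x'; rewrite !scale1r.
Qed.

Lemma gr_mul_class V y : gr_mul (gr_class V) y = T V y.
Proof. exact: (gr_lift_class (U := quot_mod (@gr_rel k (fiber m))) (@mul_ex y)). Qed.

Lemma gr_mulE V W : gr_mul (gr_class V) (gr_class W) = gr_class (@tens_mod k H C m V W).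
Proof. by rewrite gr_mul_class T_class. Qed.

Lemma gr_mulDr x (y y' : Gr (fiber m)) :
  gr_mul x (y + y') = gr_mul x y + gr_mul x y'.
Proof.
move: x; apply: (gr_ext (f := fun x => gr_mul x (y + y'))
  (g := fun x => gr_mul x y + gr_mul x y')).
- by move=> x x'; rewrite gr_mulDl.
- by move=> x x'; rewrite !gr_mulDl addrACA.
- by move=> V; rewrite !gr_mul_class TD.
Qed.

End GrMul.

Section GrRing.
Variables (k : fieldType) (H : hopfAlgType k) (C : central_hopf_subalg H).
Let e := counit_max C.

Definition fiber_counit (x : fiber e) : k :=
  counit (repr (x : quot_mod (ideal_gen e))).

Lemma fiber_counitE h : fiber_counit (fproj e h) = counit h.
Proof.
have ker x : x \in lin_span (ideal_gen e) -> counit x = 0.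
  elim/lin_span_min=> [|a v w Ev Ew|_ [c [y [[_ mc] ->]]]].
  - by rewrite counit0.
  - by rewrite counit_linear Ev Ew mulr0 addr0.
  - by rewrite counitM mc mul0r.
apply/eqP; rewrite -subr_eq0 /fiber_counit -mulN1r addrC -counit_linear.
rewrite addrC scaleN1r; apply/eqP/ker.
by rewrite -fproj_eq /fproj repr_qproj.
Qed.

Definition triv_act (x : fiber e) : 'M[k]_1 := (fiber_counit x)%:M.

Fact triv_act_zmod : zmod_morphism triv_act.
Proof.
move=> x y; have [{}x ->] := fproj_surj x; have [{}y ->] := fproj_surj y.
rewrite /triv_act -scaleN1r addrC -fproj_linear !fiber_counitE counit_linear.
by rewrite mulN1r raddfD raddfN addrC.
Qed.

Fact triv_act_monoid : monoid_morphism triv_act.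
Proof.
split=> [|x y]; first by rewrite /triv_act -[1]/(fproj e 1) fiber_counitE counit1.
have [{}x ->] := fproj_surj x; have [{}y ->] := fproj_surj y.
by rewrite /triv_act -fprojM !fiber_counitE counitM [LHS]scalar_mxM.
Qed.

Fact triv_act_kmap a : triv_act (kmap a) = a%:M.
Proof.
by rewrite /triv_act -[kmap a]/(fproj e a%:A) fiber_counitE counitZ counit1 mulr1.
Qed.

Definition triv_mod : fdmod (fiber e) :=
  FdMod triv_act_zmod triv_act_monoid triv_act_kmap.

Variable m : maxSpec C.

Lemma triv_mod_tens (V : fdmod (fiber m)) : fdiso V (tens_mod triv_mod V).
Proof.
apply: (@cast_fdiso _ _ V (tens_mod triv_mod V) (esym (mul1n _))) => x.
have [{}x ->] := fproj_surj x; rewrite /= tens_actE -[in RHS](counitl x).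
have bc : bilin (fun y z : H => counit y *: z).
  split=> [y|y] a v w; first by rewrite counit_linear scalerDl scalerA.
  by rewrite scalerDr !scalerA mulrC.
have cl : linear (castmx (esym (mul1n (fddim V)), esym (mul1n (fddim V)))
    : 'M[k]_(fddim V) -> _).
  exact: castmx_linear.
move: (comul x); apply: (tens_ext
  (f := fun t => tens_lift _ t) (g := fun t => castmx _ (fdact V (fproj m (tens_lift _ t))))).
- exact: tens_lift_linear (hact_bilin triv_mod V).
- apply: (lin_comp cl); apply: (lin_comp (@fdact_linear _ _ _ _ _)).
  exact: lin_comp (@fproj_linear _ _ _ m) (tens_lift_linear bc).
move=> y z; rewrite (tens_liftE (hact_bilin triv_mod V)) (tens_liftE bc).
rewrite /= /triv_act fiber_counitE (linZ (@fproj_linear _ _ _ m)).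
by rewrite (linZ (@fdact_linear _ _ _ _ _)) tens_scalar_mx.
Qed.

Lemma tens_triv_mod (V : fdmod (fiber e)) : fdiso V (tens_mod V triv_mod).
Proof.
apply: (@cast_fdiso _ _ V (tens_mod V triv_mod) (esym (muln1 _))) => x.
have [{}x ->] := fproj_surj x; rewrite /= tens_actE -[in RHS](counitr x).
have bc : bilin (fun y z : H => counit z *: y).
  split=> [y|y] a v w; last by rewrite counit_linear scalerDl scalerA.
  by rewrite scalerDr !scalerA mulrC.
have cl : linear (castmx (esym (muln1 (fddim V)), esym (muln1 (fddim V)))
    : 'M[k]_(fddim V) -> _).
  exact: castmx_linear.
move: (comul x); apply: (tens_ext
  (f := fun t => tens_lift _ t) (g := fun t => castmx _ (fdact V (fproj e (tens_lift _ t))))).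
- exact: tens_lift_linear (hact_bilin V triv_mod).
- apply: (lin_comp cl); apply: (lin_comp (@fdact_linear _ _ _ _ _)).
  exact: lin_comp (@fproj_linear _ _ _ e) (tens_lift_linear bc).
move=> y z; rewrite (tens_liftE (hact_bilin V triv_mod)) (tens_liftE bc).
rewrite /= /triv_act fiber_counitE (linZ (@fproj_linear _ _ _ e)).
by rewrite (linZ (@fdact_linear _ _ _ _ _)) tens_mx_scalar.
Qed.

Lemma tens_modA (U V : fdmod (fiber e)) (W : fdmod (fiber m)) :
  fdiso (tens_mod (tens_mod U V) W) (tens_mod U (tens_mod V W)).
Proof.
apply: (@cast_fdiso _ _ (tens_mod (tens_mod U V) W) (tens_mod U (tens_mod V W))
  (esym (mulnA _ _ _))) => x.
have [{}x ->] := fproj_surj x; rewrite /= !tens_actE.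
pose hU y := fdact U (fproj e y); pose hV y := fdact V (fproj e y).
pose hW y := fdact W (fproj m y).
have lU : linear hU := lin_comp (@fdact_linear _ _ _ _ _) (@fproj_linear _ _ _ e).
have lV : linear hV := lin_comp (@fdact_linear _ _ _ _ _) (@fproj_linear _ _ _ e).
have lW : linear hW := lin_comp (@fdact_linear _ _ _ _ _) (@fproj_linear _ _ _ m).
have bVW := hact_bilin V W; have bUV := hact_bilin U V.
pose n := (fddim U * (fddim V * fddim W))%N.
pose F (t : tens H (tens H H)) : 'M[k]_n :=
  tens_lift (fun y t' => hU y *t tens_lift (fun z w => hV z *t hW w) t') t.
have [tl tr] := tensmx_bilin k (fddim U) (fddim U) (fddim V * fddim W) (fddim V * fddim W).
have bF : bilin (fun y (t' : tens H H) => hU y *t tens_lift (fun z w => hV z *t hW w) t').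
  split=> [t'|y] a u v; first by rewrite lU tl.
  by rewrite (tens_lift_linear bVW) tr.
have lF : linear F := tens_lift_linear bF.
have Er : F (tens_map id comul (comul x)) =
    tens_lift (fun y z => fdact U (fproj e y) *t tens_act V W (fproj m z)) (comul x).
  move: (comul x); apply: (tens_ext (f := fun t => F (tens_map _ _ t))).
  - apply: lin_comp lF _; apply: tens_map_linear => //; exact: comul_linear.
  - exact: tens_lift_linear (hact_bilin U (tens_mod V W)).
  move=> y z; rewrite tens_mapE //; last exact: comul_linear.
  rewrite /F (tens_liftE bF) (tens_liftE (hact_bilin U (tens_mod V W))).
  by rewrite /= tens_actE.
rewrite -[LHS]Er -comulA.
have cl : linear (castmx (esym (mulnA (fddim U) (fddim V) (fddim W)),
    esym (mulnA (fddim U) (fddim V) (fddim W))) : 'M[k]_(_, _) -> 'M[k]_n).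
  exact: castmx_linear.
have lcu : linear (@comul k H) := @comul_linear k H.
have bp (w : H) : bilin (fun u v : H => pure u (pure v w)).
  by split=> [v|u] a y z /=; rewrite pure_linearl ?pure_linearr.
have ba : bilin (fun (t : tens H H) (w : H) => tens_lift (fun u v => pure u (pure v w)) t).
  split=> [w|t].
    by move=> a t t'; have := tens_lift_linear (bp w) a t t'.
  move=> a y z.
  move: t; apply: (tens_ext (f := fun t => tens_lift _ t)
    (g := fun t => a *: tens_lift _ t + tens_lift _ t)) => [||u v].
  - exact: tens_lift_linear.
  - by move=> d v w; rewrite !tens_lift_linear // !scalerDr !scalerA mulrC addrACA.
  - by rewrite !tens_liftE // pure_linearr pure_linearr.
move: (comul x); apply: (tens_ext (f := fun t => F (tens_assoc (tens_map _ _ t)))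
  (g := fun t => castmx _ (tens_lift _ t))).
- apply: lin_comp lF _; apply: lin_comp (tens_lift_linear ba) _.
  by apply: tens_map_linear.
- by apply: (lin_comp cl); exact: tens_lift_linear (hact_bilin (tens_mod U V) W).
move=> y z; rewrite tens_mapE // (tens_liftE (hact_bilin (tens_mod U V) W)) /=.
rewrite [tens_assoc _](tens_liftE ba) tens_actE; move: (comul y).
have [tl' _] := tensmx_bilin k (fddim U * fddim V) (fddim U * fddim V) (fddim W) (fddim W).
apply: (tens_ext (f := fun t => F (tens_lift _ t))
  (g := fun t => castmx _ (tens_lift _ t *t _))) => [||u v].
- exact: lin_comp lF (tens_lift_linear (bp z)).
- apply: (lin_comp cl); exact: lin_comp (tl' _) (tens_lift_linear bUV).
rewrite (tens_liftE (bp z)) (tens_liftE bUV) /F (tens_liftE bF) (tens_liftE bVW).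
exact: tensmxA.
Qed.

Lemma gr_mulA (x y : Gr (fiber e)) (z : Gr (fiber m)) :
  gr_mul x (gr_mul y z) = gr_mul (gr_mul x y) z.
Proof.
move: x; apply: (gr_ext (f := fun x => gr_mul x _) (g := fun x => gr_mul (gr_mul x _) _)).
- by move=> x x'; rewrite gr_mulDl.
- by move=> x x'; rewrite !gr_mulDl.
move=> U; move: y; apply: (gr_ext (f := fun y => gr_mul _ (gr_mul y _))
  (g := fun y => gr_mul (gr_mul _ y) _)).
- by move=> y y'; rewrite gr_mulDl gr_mulDr.
- by move=> y y'; rewrite gr_mulDr gr_mulDl.
move=> V; move: z; apply: (gr_ext (f := fun z => gr_mul _ (gr_mul _ z))
  (g := fun z => gr_mul _ z)).
- by move=> z z'; rewrite !gr_mulDr.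
- by move=> z z'; rewrite !gr_mulDr.
by move=> W; rewrite !gr_mulE (gr_class_iso (tens_modA U V W)).
Qed.

Lemma gr_mul1l (x : Gr (fiber m)) : gr_mul (gr_class triv_mod) x = x.
Proof.
move: x; apply: (gr_ext (f := gr_mul _) (g := id)) => //.
  by move=> x y; rewrite gr_mulDr.
by move=> V; rewrite gr_mulE -(gr_class_iso (triv_mod_tens V)).
Qed.

Lemma gr_mul1r (x : Gr (fiber e)) : gr_mul x (gr_class triv_mod) = x.
Proof.
move: x; apply: (gr_ext (f := fun x => gr_mul x _) (g := id)) => //.
  by move=> x y; rewrite gr_mulDl.
by move=> V; rewrite gr_mulE -(gr_class_iso (tens_triv_mod V)).
Qed.

End GrRing.

Section GrStructures.
Variables (k : fieldType) (H : hopfAlgType k) (C : central_hopf_subalg H).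

Definition gr_ring : Type := Gr (fiber (counit_max C)).
HB.instance Definition _ := GRing.Zmodule.on gr_ring.
HB.instance Definition _ := GRing.Zmodule_isPzRing.Build gr_ring
  (@gr_mulA _ _ C (counit_max C)) (@gr_mul1l _ _ C (counit_max C))
  (@gr_mul1r _ _ C) (@gr_mulDl _ _ C (counit_max C))
  (@gr_mulDr _ _ C (counit_max C)).

Variable m : maxSpec C.

Definition gr_module : Type := Gr (fiber m).
HB.instance Definition _ := GRing.Zmodule.on gr_module.

Fact gr_scaleDl (y : gr_module) :
  {morph (fun x : gr_ring => gr_mul x y : gr_module) : x x' / x + x'}.
Proof. by move=> x x'; exact: gr_mulDl. Qed.

HB.instance Definition _ := GRing.Zmodule_isLmodule.Build gr_ring gr_module
  (@gr_mulA _ _ C m) (@gr_mul1l _ _ C m) (@gr_mulDr _ _ C m) gr_scaleDl.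

Definition gr_ring_basis : Irr (fiber (counit_max C)) -> gr_ring :=
  @irr_class k (fiber (counit_max C)).

Definition gr_module_basis : Irr (fiber m) -> gr_module :=
  @irr_class k (fiber m).

End GrStructures.
Arguments gr_ring_basis {k H} C _.
Arguments gr_module_basis {k H C} m _.

Section ZplusModules.

Definition zbasis (M : zmodType) (L : choiceType) (b : L -> M) := forall x : M,
  exists! D : {freeg L / int}, x = \sum_(l <- dom D) b l *~ coeff l D.

Definition zplus_comb (M : zmodType) (L : Type) (b : L -> M) (x : M) :=
  exists s : seq (nat * L), x = \sum_(p <- s) b p.2 *+ p.1.

Definition zspan (M : zmodType) (L : choiceType) (b : L -> M) (J : set L)
    (x : M) :=
  exists2 s : seq (int * L), {in s, forall p, J p.2}
    & x = \sum_(p <- s) b p.2 *~ p.1.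

Definition zplus_ring (R : pzRingType) (I : choiceType) (b : I -> R) :=
  zbasis b /\ forall i j, zplus_comb b (b i * b j).

Definition zplus_module (R : pzRingType) (I : choiceType) (b : I -> R)
    (M : lmodType R) (L : choiceType) (m : L -> M) :=
  zbasis m /\ forall i l, zplus_comb m (b i *: m l).

Definition irreducible_zplus_module (R : pzRingType) (I : choiceType) (b : I -> R)
    (M : lmodType R) (L : choiceType) (m : L -> M) :=
  [/\ zplus_ring b, zplus_module b m
    & forall J : set L,
        (forall (r : R) (x : M), zspan m J x -> zspan m J (r *: x)) ->
        J = set0 \/ J = setT].

End ZplusModules.

(* Main.v *)
Require Import Defs.
From HB Require Import structures.
From mathcomp Require Import all_boot all_order all_algebra.
From mathcomp Require Import freeg mxtens.
From mathcomp Require Import boolp classical_sets.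

(** For finite-dimensional H/mH-modules V and W, the space W (x) V^* of linear
    maps from V to W is an H-module, h acting on it through h_1 (x) S(h_2).
    The central subalgebra C acts on every H/mH-module by one and the same
    character chi: C -> k, so c in C acts on W (x) V^* by the scalar
    chi(c_1) chi(S c_2) = chi(c_1 S(c_2)) = counit c; hence W (x) V^* is a
    module over the fiber at the counit.  The evaluation map
    (W (x) V^* ) (x) V -> W is H-linear, by S(h_1) h_2 = counit h, and it is
    surjective as soon as V is nonzero ([eval_hom], [eval_surj]).  So every
    simple W is a composition factor of X (x) V for some module X over the
    fiber at the counit: if the span of J is stable and contains [V], it
    contains [X][V], in which [W] occurs with a positive coefficient, whence
    [W] is in J.

    Two facts need work.  The first is that C acts by scalars at all, which
    asks that every c in C be congruent to a scalar modulo m.  The Nullstellensatz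
    is avoided here: a nonzero module V over the fiber is at hand, c has
    an eigenvalue a on V, and the ideal m + C (c - a) is proper, as 1 in it would
    make c - a invertible on V; by maximality c - a lies in m
    ([residue_field]).  The second is that the antipode reverses products
    ([antipodeM]), which makes h |-> S(h)^T a representation.

    To speak of the coefficient of [W] one needs that the simple modules form a
    basis of the Grothendieck group.  This is the Jordan-Hoelder theorem
    ([jordan_holder]): the list of composition factors of a module is
    well defined up to order and additive on short exact sequences, so it
    induces a linear map from the Grothendieck group to the free abelian group
    on the simple modules, which is inverse to the obvious map the other way
    ([irr_class_zbasis]).  Since composition factors are counted by natural
    numbers, products of basis elements are non-negative combinations. *)

Set Implicit Arguments.
Unset Strict Implicit.
Unset Printing Implicit Defensive.

Import GRing.Theory.
Local Open Scope ring_scope.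
Local Open Scope quotient_scope.

(** * Splitting injective and surjective matrices *)

Section SplitMatrices.
Variable k : fieldType.

Lemma mx_dim0 m n (u v : 'M[k]_(m, n)) : m = 0%N -> u = v.
Proof. by move=> m0; move: u v; rewrite m0 => u v; apply/matrixP => -[]. Qed.

Lemma inj_left_inverse n r (f : 'M[k]_(n, r)) :
  injective (fun u : 'cV_r => f *m u) -> exists t, t *m f = 1%:M.
Proof.
move=> finj; have : row_free f^T.
  apply: inj_row_free => v /(congr1 trmx); rewrite trmx_mul trmxK trmx0 => E.
  by apply: trmx_inj; rewrite trmx0; apply: finj; rewrite E mulmx0.
move/row_freeP=> [B E]; exists B^T.
by apply: trmx_inj; rewrite trmx_mul trmxK E trmx1.
Qed.

Lemma surj_right_inverse n r (g : 'M[k]_(r, n)) :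
  (forall w : 'cV_r, exists v, w = g *m v) -> exists s, g *m s = 1%:M.
Proof.
move=> gsurj; have /= H (j : 'I_r) : exists u : 'cV_n, col j 1%:M = g *m u.
  exact: gsurj.
have [u Hu] := choice H; exists (\matrix_(i, j) u j i ord0).
apply/matrixP => i j; have := Hu j; move/matrixP/(_ i ord0).
by rewrite !mxE => ->; apply: eq_bigr => l _; rewrite mxE.
Qed.

(** A full-rank factorization of an idempotent splits it: cancelling the outer
    factors in P P = P leaves the identity in the middle. *)
Lemma idempotent_factor n (P : 'M[k]_n) : P *m P = P ->
  col_base P *m row_base P = P /\ row_base P *m col_base P = 1%:M.
Proof.
move=> PP; split; first exact: mulmx_base.
have /row_freeP[R HR] := row_base_free P.
have /row_fullP[L HL] := col_base_full P.
have := mulmx_base P; move: (col_base P) (row_base P) HL HR => c r HL HR E.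
have : c *m (r *m c) *m r = c *m r by rewrite mulmxA E -mulmxA E PP.
move: (r *m c) => M /(congr1 (mulmx^~ R)).
rewrite /= -!mulmxA HR !mulmx1 => /(congr1 (mulmx L)).
by rewrite mulmxA HL mul1mx.
Qed.

(** The complement is cut out by the idempotent 1 - f t. *)
Lemma left_inverse_split n r (f : 'M[k]_(n, r)) t : t *m f = 1%:M ->
  exists q (g : 'M_(q, n)) s,
  [/\ g *m f = 0, g *m s = 1%:M & f *m t + s *m g = 1%:M].
Proof.
move=> tf; set P := 1%:M - f *m t.
have Pf : P *m f = 0 by rewrite mulmxBl mul1mx -mulmxA tf mulmx1 subrr.
have /idempotent_factor[] : P *m P = P.
  by rewrite {2}/P mulmxBr mulmx1 mulmxA Pf mul0mx subr0.
move: (col_base P) (row_base P) => s g E gs; exists (\rank P), g, s; split=> //.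
  by rewrite -[LHS]mul1mx -gs -mulmxA (mulmxA s) E Pf mulmx0.
by rewrite E addrC subrK.
Qed.

Lemma right_inverse_split n r (g : 'M[k]_(r, n)) s : g *m s = 1%:M ->
  exists q (f : 'M_(n, q)) t,
  [/\ g *m f = 0, t *m f = 1%:M & f *m t + s *m g = 1%:M].
Proof.
move=> gs; have sg : s^T *m g^T = 1%:M by rewrite -trmx_mul gs trmx1.
have [q [f [t [gf tf E]]]] := left_inverse_split sg; exists q, f^T, t^T.
split; apply: trmx_inj.
- by rewrite trmx_mul trmxK gf trmx0.
- by rewrite trmx_mul !trmxK tf trmx1.
- by rewrite raddfD /= !trmx_mul !trmxK addrC E trmx1.
Qed.

(** The block matrices (f s) and (t ; g) are mutually inverse. *)
Lemma split_dim n r q (f : 'M[k]_(n, r)) t (g : 'M_(q, n)) s :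
  t *m f = 1%:M -> g *m f = 0 -> g *m s = 1%:M -> f *m t + s *m g = 1%:M ->
  n = (r + q)%N.
Proof.
move=> tf gf gs fs.
have ts : t *m s = 0.
  have : t *m (f *m t + s *m g) *m s = t *m s by rewrite fs mulmx1.
  rewrite mulmxDr mulmxDl !mulmxA tf mul1mx -[_ *m g *m s]mulmxA gs mulmx1.
  by move/eqP; rewrite -subr_eq0 addrK => /eqP.
apply/eqP; rewrite eqn_leq; apply/andP; split.
  by apply: (@mulmx1_min _ _ _ (row_mx f s) (col_mx t g)); rewrite mul_row_col.
apply: (@mulmx1_min _ _ _ (col_mx t g) (row_mx f s)).
by rewrite mul_col_row tf ts gf gs -scalar_mx_block.
Qed.

End SplitMatrices.

(** * Kernels, cokernels and factorization of module maps *)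

Section Modules.
Variables (k : fieldType) (A : kAlgType k).
Implicit Types U V W S : fdmod A.

(** [short_exact] with its two maps made explicit. *)
Definition exact_seq U V W (f : 'M[k]_(fddim V, fddim U))
    (g : 'M[k]_(fddim W, fddim V)) :=
  [/\ fdhom f /\ fdhom g,
      injective (fun u : 'cV_(fddim U) => f *m u),
      forall w : 'cV_(fddim W), exists v, w = g *m v
    & forall v : 'cV_(fddim V), g *m v = 0 <-> exists u, v = f *m u].

Lemma fdhom_comp U V W (g : 'M_(fddim W, fddim V)) (f : 'M_(fddim V, fddim U)) :
  fdhom g -> fdhom f -> fdhom (g *m f).
Proof. by move=> hg hf x; rewrite -mulmxA hf mulmxA hg mulmxA. Qed.

(* A submodule or a quotient of V comes with matrices f and t, t f = 1, that
   identify it with a retract of the underlying space of V.  Its action is the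
   compression t (-) f, which is multiplicative when the image of f or the kernel
   of t is stable. *)
Section Compress.
Variables (V : fdmod A) (r : nat) (f : 'M[k]_(fddim V, r)) (t : 'M[k]_(r, fddim V)).
Hypothesis tf : t *m f = 1%:M.
Hypothesis multH : forall x y, t *m fdact V x *m f *m (t *m fdact V y *m f) =
  t *m (fdact V x *m fdact V y) *m f.
Definition compress_act x := t *m fdact V x *m f.

Lemma compress_zmod : zmod_morphism compress_act.
Proof. by move=> x y; rewrite /compress_act fdact_zmod mulmxBr mulmxBl. Qed.

Lemma compress_monoid : monoid_morphism compress_act.
Proof.
rewrite /compress_act; have [a1 aM] := fdact_monoid V.
by split=> [|x y]; rewrite ?a1 ?mulmx1 // aM; exact/esym/multH.
Qed.

Lemma compress_kmap a : compress_act (kmap a) = a%:M.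
Proof.
by rewrite /compress_act fdact_kmap mul_mx_scalar -scalemxAl tf scalemx1.
Qed.

Definition compress : fdmod A :=
  FdMod compress_zmod compress_monoid compress_kmap.
End Compress.

Lemma exists_submodule V r (f : 'M[k]_(fddim V, r)) t : t *m f = 1%:M ->
  (forall x, f *m t *m fdact V x *m f = fdact V x *m f) ->
  exists U (f' : 'M_(fddim V, fddim U)) t',
    [/\ fdhom f', t' *m f' = 1%:M, f' *m t' = f *m t & fddim U = r].
Proof.
move=> tf st; have multH x y : t *m fdact V x *m f *m (t *m fdact V y *m f) =
    t *m (fdact V x *m fdact V y) *m f.
  by rewrite -[LHS]mulmxA !(mulmxA f) st !mulmxA.
exists (compress tf multH), f, t; split=> // x.
by rewrite /= /compress_act !mulmxA st.
Qed.

Lemma hom_kernel V W (g : 'M_(fddim W, fddim V)) : fdhom g ->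
  (forall w : 'cV_(fddim W), exists v, w = g *m v) ->
  exists U (f : 'M_(fddim V, fddim U)), exact_seq f g.
Proof.
move=> hg gsurj; have [s gs] := surj_right_inverse gsurj.
have [r [f0 [t0 [gf0 tf0 E0]]]] := right_inverse_split gs.
have st x : f0 *m t0 *m fdact V x *m f0 = fdact V x *m f0.
  rewrite -[f0 *m t0](addrK (s *m g)) E0 !mulmxBl mul1mx -(mulmxA s) hg -!mulmxA.
  by rewrite gf0 !mulmx0 subr0.
have [U [f [t [hf tf E _]]]] := exists_submodule tf0 st.
exists U, f; split=> //.
- by move=> u v /(congr1 (mulmx t)); rewrite !mulmxA tf !mul1mx.
move=> v; split=> [gv|[u ->]].
  exists (t *m v); rewrite -[LHS]mul1mx -E0 mulmxDl -(mulmxA s) gv mulmx0 addr0.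
  by rewrite -E mulmxA.
by rewrite -[f]mulmx1 -tf (mulmxA f) E !mulmxA gf0 !mul0mx.
Qed.

Lemma hom_cokernel U V (f : 'M_(fddim V, fddim U)) : fdhom f ->
  injective (fun u : 'cV_(fddim U) => f *m u) ->
  exists W (g : 'M_(fddim W, fddim V)), exact_seq f g.
Proof.
move=> hf finj; have [t tf] := inj_left_inverse finj.
have [r [g [s [gf gs E]]]] := left_inverse_split tf.
have st x : g *m fdact V x *m s *m g = g *m fdact V x.
  rewrite -[_ *m s *m g]mulmxA -[s *m g](addKr (f *m t)) E addrC mulmxBr mulmx1.
  by rewrite -!mulmxA (mulmxA _ f) -hf !mulmxA gf !mul0mx subr0.
have multH x y : g *m fdact V x *m s *m (g *m fdact V y *m s) =
    g *m (fdact V x *m fdact V y) *m s.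
  by rewrite !mulmxA st.
exists (compress gs multH), g; split.
- by split=> // x; rewrite /= /compress_act st.
- by [].
- by move=> w; exists (s *m w); rewrite mulmxA gs mul1mx.
move=> v; split=> [gv|[u ->]]; last by rewrite mulmxA gf mul0mx.
by exists (t *m v); rewrite -[LHS]mul1mx -E mulmxDl -!mulmxA gv mulmx0 addr0.
Qed.

Lemma short_exact_dim U V W : short_exact U V W ->
  fddim V = (fddim U + fddim W)%N.
Proof.
by case/short_exact_split=> f [g [t [s [_ gf tf gs E]]]]; exact: split_dim tf gf gs E.
Qed.

Lemma factor_surj U V W Z (f : 'M_(fddim V, fddim U)) (g : 'M_(fddim W, fddim V))
    (p : 'M_(fddim Z, fddim V)) :
  exact_seq f g -> fdhom p -> p *m f = 0 ->
  exists2 q : 'M_(fddim Z, fddim W), fdhom q & p = q *m g.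
Proof.
move=> [[hf hg] finj gsurj ex] hp pf; have [s gs] := surj_right_inverse gsurj.
have pE : p *m s *m g = p.
  apply/matrixP => i j.
  have: p *m (s *m g *m delta_mx j 0 - delta_mx j 0) = 0 :> 'cV_ _.
    case: (proj1 (ex (s *m g *m delta_mx j 0 - delta_mx j 0))) => [|u ->].
      by rewrite mulmxBr !mulmxA gs mul1mx subrr.
    by rewrite mulmxA pf mul0mx.
  rewrite mulmxBr !mulmxA -!colE => /eqP; rewrite subr_eq0 => /eqP/matrixP/(_ i 0).
  by rewrite !mxE.
exists (p *m s) => // x.
rewrite -[LHS]mulmx1 -gs mulmxA -[_ *m _ *m g]mulmxA -hg mulmxA pE hp.
by rewrite !mulmxA.
Qed.

End Modules.

(** * Maps from and to simple modules *)

Section Submodules.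
Variables (k : fieldType) (A : kAlgType k).
Implicit Types U V W S Z : fdmod A.

Lemma eq_mulmx_cV m n (M N : 'M[k]_(m, n)) :
  (forall v : 'cV_n, M *m v = N *m v) -> M = N.
Proof.
move=> E; apply/matrixP => i j; have := E (delta_mx j 0).
by rewrite -!colE => /matrixP/(_ i 0); rewrite !mxE.
Qed.

Lemma exact_comp0 U V W (f : 'M_(fddim V, fddim U)) (g : 'M_(fddim W, fddim V)) :
  exact_seq f g -> g *m f = 0.
Proof.
move=> [_ _ _ ex]; apply: eq_mulmx_cV => u.
by rewrite mul0mx -mulmxA; apply/ex; exists u.
Qed.

Lemma factor_inj U V W Z (f : 'M_(fddim V, fddim U)) (g : 'M_(fddim W, fddim V))
    (p : 'M_(fddim V, fddim Z)) :
  exact_seq f g -> fdhom p -> g *m p = 0 ->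
  exists2 q : 'M_(fddim U, fddim Z), fdhom q & p = f *m q.
Proof.
move=> [[hf hg] finj gsurj ex] hp gp; have [t tf] := inj_left_inverse finj.
have pE : p = f *m (t *m p).
  apply: eq_mulmx_cV => u; have [|w E] := proj1 (ex (p *m u)).
    by rewrite mulmxA gp mul0mx.
  by rewrite -!mulmxA E (mulmxA t) tf mul1mx.
exists (t *m p) => // x.
have fE : f *m (t *m p *m fdact Z x) = f *m (fdact U x *m (t *m p)).
  by rewrite mulmxA -pE hp [RHS]mulmxA hf -mulmxA -pE.
by have := congr1 (mulmx t) fE; rewrite !mulmxA tf !mul1mx.
Qed.

(** Schur's lemma for maps out of a simple module: the kernel is stable. *)
Lemma irr_hom_inj S Z (h : 'M_(fddim Z, fddim S)) : fdirr S -> fdhom h ->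
  h = 0 \/ injective (fun u : 'cV_(fddim S) => h *m u).
Proof.
move=> [_ irr] hh; pose X := lker (linfun (mulmx h : 'cV_(fddim S) -> 'cV_(fddim Z))).
have memX u : (u \in X) = (h *m u == 0) by rewrite memv_ker lfunE.
have [x v|X0|XT] := irr X.
- by rewrite !memX mulmxA hh -mulmxA => /eqP ->; rewrite mulmx0.
- right=> u v /= E; apply/eqP; rewrite -subr_eq0 -memv0 -X0 memX mulmxBr E.
  by rewrite subrr.
- left; apply: eq_mulmx_cV => u; rewrite mul0mx; apply/eqP.
  by rewrite -memX XT memvf.
Qed.

(** Schur's lemma for maps into a simple module: the image is stable. *)
Lemma irr_hom_surj Z S (h : 'M_(fddim S, fddim Z)) : fdirr S -> fdhom h ->
  h = 0 \/ forall w : 'cV_(fddim S), exists v, w = h *m v.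
Proof.
move=> [_ irr] hh; pose X := limg (linfun (mulmx h : 'cV_(fddim Z) -> 'cV_(fddim S))).
have memX u : reflect (exists v, u = h *m v) (u \in X).
  apply: (iffP memv_imgP) => [[v _ ->]|[v ->]]; exists v; rewrite ?lfunE ?memvf //.
have [x u /memX[v ->]|X0|XT] := irr X.
- by apply/memX; exists (fdact Z x *m v); rewrite !mulmxA hh.
- left; apply: eq_mulmx_cV => u; rewrite mul0mx; apply/eqP.
  by rewrite -memv0 -X0; apply/memX; exists u.
- by right=> w; apply/memX; rewrite XT memvf.
Qed.

Lemma stable_submodule V (X : {vspace 'cV[k]_(fddim V)}) :
  (forall x, {in X, forall v, fdact V x *m v \in X}) ->
  exists U W, short_exact U V W /\ fddim U = \dim X.
Proof.
move=> stX; pose f := \matrix_(i < fddim V, j < \dim X) (vbasis X)`_j i 0.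
have fE u : f *m u = \sum_j u j 0 *: (vbasis X)`_j.
  apply/matrixP => i j; rewrite !mxE summxE; apply: eq_bigr => l _.
  by rewrite !mxE ord1 mulrC.
have finj : injective (fun u : 'cV_(\dim X) => f *m u).
  move=> u v /= E; apply/matrixP => i j; rewrite ord1.
  have := basis_free (vbasisP X) => /freeP/(_ (fun i => u i 0 - v i 0)) H.
  apply/eqP; rewrite -subr_eq0; apply/eqP/H.
  under eq_bigr do rewrite scalerBl.
  by rewrite sumrB -!fE E subrr.
have fX u : f *m u \in X.
  rewrite fE; apply: memv_suml => j _; apply/memvZ/vbasis_mem/mem_nth.
  by rewrite size_tuple.
have Xf v : v \in X -> exists u, v = f *m u.
  move=> vX; exists (\col_j coord (vbasis X) j v).
  rewrite fE {1}(coord_vbasis vX); apply: eq_bigr => j _; by rewrite mxE.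
have [t tf] := inj_left_inverse finj.
have [|U [f' [t' [hf' tf' _ dU]]]] := exists_submodule tf.
  move=> x; apply: eq_mulmx_cV => u; rewrite -!mulmxA.
  by have [w ->] := Xf _ (stX x _ (fX u)); rewrite (mulmxA t) tf mul1mx.
have [|W [g ex]] := hom_cokernel hf'.
  by move=> u v /(congr1 (mulmx t')); rewrite !mulmxA tf' !mul1mx.
by exists U, W; split=> //; exists f', g.
Qed.

Lemma short_exact_iso S V V' W : fdiso V V' -> short_exact S V W ->
  short_exact S V' W.
Proof.
move=> iso; case: (iso) => [p [q [hp pq qp]]].
case/short_exact_split => f [g [t [s [[hf hg] gf tf gs E]]]].
have hq : fdhom q.
  move=> x; rewrite -[LHS]mulmx1 -pq !mulmxA -[q *m _ *m p]mulmxA -hp mulmxA qp.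
  by rewrite mul1mx.
apply: (@split_short_exact _ _ _ _ _ (p *m f) (g *m q) (t *m q) (p *m s)).
- exact: fdhom_comp.
- exact: fdhom_comp.
- by rewrite mulmxA -(mulmxA g) qp mulmx1.
- by rewrite mulmxA -(mulmxA t) qp mulmx1.
- by rewrite mulmxA -(mulmxA g) qp mulmx1.
- by rewrite !mulmxA -mulmxDl -!(mulmxA p) -mulmxDr E mulmx1.
Qed.

Lemma bij_fdiso V W (g : 'M_(fddim W, fddim V)) : fdhom g ->
  injective (fun u : 'cV_(fddim V) => g *m u) ->
  (forall w : 'cV_(fddim W), exists v, w = g *m v) -> fdiso V W.
Proof.
move=> hg /inj_left_inverse[t tg] /surj_right_inverse[s gs].
by exists g, t; split=> //; rewrite -[g *m t]mulmx1 -gs -!mulmxA (mulmxA t) tg mul1mx.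
Qed.

(** The third isomorphism theorem: a submodule S of U remains a submodule of V,
    and U/S is a submodule of V/S with quotient W = V/U. *)
Lemma quotient_by_sub S U V W U' : short_exact S U U' -> short_exact U V W ->
  exists V', short_exact S V V' /\ short_exact U' V' W.
Proof.
move=> [f1 [g1 ex1]] [f2 [g2 ex2]].
have [[hf1 hg1] inj1 surj1 e1] := ex1; have [[hf2 hg2] inj2 surj2 e2] := ex2.
have gf1 := exact_comp0 ex1; have gf2 := exact_comp0 ex2.
have [|V' [q exq]] := hom_cokernel (fdhom_comp hf2 hf1).
  by move=> u v; rewrite /= -!mulmxA => /inj2/inj1.
have [[_ hq] _ surjq eq] := exq.
have [|p hp pq] := factor_surj exq hg2; first by rewrite mulmxA gf2 mul0mx.
have [|j hj jg] := factor_surj ex1 (fdhom_comp hq hf2).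
  by rewrite -mulmxA exact_comp0.
exists V'; split; first by exists (f2 *m f1), q.
exists j, p; split=> //.
- move=> u v /=; have [u' ->] := surj1 u; have [v' ->] := surj1 v.
  rewrite !mulmxA -jg -!mulmxA => /eqP; rewrite -subr_eq0 -!mulmxBr => /eqP.
  case/eq => x; rewrite -mulmxA => /inj2 E; apply/eqP; rewrite -subr_eq0 -mulmxBr E.
  by rewrite mulmxA gf1 mul0mx.
- by move=> w; have [v ->] := surj2 w; exists (q *m v); rewrite mulmxA pq.
move=> v; have [v' ->] := surjq v; split.
  rewrite mulmxA -pq => /e2[u ->]; exists (g1 *m u); by rewrite !mulmxA jg.
move=> [u]; have [u' ->] := surj1 u; rewrite [j *m _]mulmxA -jg => ->.
by rewrite !mulmxA -pq gf2 mul0mx.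
Qed.

(** The diamond step of the Jordan-Hoelder theorem.  The composite
    S' -> V -> V/S is zero or injective.  In the first case S' and S are the same
    submodule; in the second, S + S' is a direct sum in V and both V/S and V/S'
    have the quotient Q = V/(S + S'). *)
Lemma two_simple_subs S S' V W W' : fdirr S -> fdirr S' ->
  short_exact S V W -> short_exact S' V W' ->
  fdiso S' S /\ fdiso W W' \/
  exists Q, short_exact S' W Q /\ short_exact S W' Q.
Proof.
move=> iS iS' [f [g ex]] [f' [g' ex']].
have [[hf hg] finj gsurj e] := ex; have [[hf' hg'] finj' gsurj' e'] := ex'.
have gf := exact_comp0 ex; have gf' := exact_comp0 ex'.
have [gf0|hinj] := irr_hom_inj iS' (fdhom_comp hg hf').
  left; have [q hq gE] := factor_inj ex hf' gf0.
  have q0 : q <> 0.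
    move=> q0; move: finj'; rewrite gE q0 mulmx0 => /(_ (const_mx 1) 0).
    rewrite /= !mul0mx => /(_ erefl); have [Spos _] := iS'.
    by move=> /matrixP/(_ (Ordinal Spos) 0); rewrite !mxE => /eqP; rewrite oner_eq0.
  have [//|qinj] := irr_hom_inj iS' hq; have [//|qsurj] := irr_hom_surj iS hq.
  split; first exact: bij_fdiso hq qinj qsurj.
  have [|p hp pE] := factor_surj ex hg'; last first.
    apply: bij_fdiso hp _ _.
      move=> u v /=; have [{}u ->] := gsurj u; have [{}v ->] := gsurj v.
      rewrite !mulmxA -pE => /eqP; rewrite -subr_eq0 -mulmxBr => /eqP/e'[w E].
      apply/eqP; rewrite -subr_eq0 -mulmxBr E gE !mulmxA gf !mul0mx //.
    by move=> w; have [v ->] := gsurj' w; exists (g *m v); rewrite mulmxA pE.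
  apply: eq_mulmx_cV => u; have [v ->] := qsurj u.
  by rewrite mulmxA -(mulmxA g') -gE gf' !mul0mx.
right; have [Q [p exp]] := hom_cokernel (fdhom_comp hg hf') hinj.
have [[_ hp] _ psurj ep] := exp; exists Q; split; first by exists (g *m f'), p.
have [|r hr rE] := factor_surj ex' (fdhom_comp hp hg).
  by rewrite -mulmxA exact_comp0.
exists (g' *m f), r; split=> //; first by split=> //; exact: fdhom_comp.
- move=> u v /= /eqP; rewrite -subr_eq0 -mulmxBr -mulmxA => /eqP/e'[w E].
  have w0 : w = 0.
    by apply: hinj; rewrite /= -!mulmxA -E !mulmx0 !mulmxA gf mul0mx.
  by apply: finj; apply/eqP; rewrite /= -subr_eq0 -mulmxBr E w0 mulmx0.
- move=> w; have [v ->] := psurj w; have [{}v ->] := gsurj v.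
  by exists (g' *m v); rewrite !mulmxA rE.
move=> w; have [v ->] := gsurj' w; rewrite mulmxA -rE; split.
  rewrite -mulmxA => /ep[u]; rewrite -mulmxA => /eqP; rewrite -subr_eq0 -mulmxBr.
  move=> /eqP/e[x E]; exists x; rewrite -mulmxA -E mulmxBr (mulmxA g') gf' mul0mx.
  by rewrite subr0.
move=> [u]; rewrite -mulmxA => /eqP; rewrite -subr_eq0 -mulmxBr => /eqP/e'[x E].
apply/eqP; rewrite -[v](subrK (f *m u)) E mulmxDr addrC -!mulmxA (mulmxA g f) gf.
by rewrite mul0mx mulmx0 add0r; apply/eqP/ep; exists x; rewrite mulmxA.
Qed.

End Submodules.

(** * The Jordan-Hoelder theorem *)

Section JordanHolder.
Variables (k : fieldType) (A : kAlgType k).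
Implicit Types (U V W : fdmod A) (S : irr_mod A) (l : Irr A) (s : seq (Irr A)).

Definition irr_type S : Irr A := \pi_(Irr A) S.

Lemma irr_typeP S S' : irr_type S = irr_type S' <-> fdiso (val S) (val S').
Proof.
have e := @eqmodP _ (irr_iso_equivRel A) S S'.
by split=> [/(introT e)/asboolP|H] //; apply: (elimT e); apply/asboolP.
Qed.

Lemma irr_mod_irr S : fdirr (val S).
Proof. exact: asboolW (valP S). Qed.

(** Factors are split off from the bottom, starting with a simple submodule, which
    makes the definition structural on the list. *)
Fixpoint comp_series V s : Prop :=
  if s is l :: s' then
    exists S W, [/\ irr_type S = l, short_exact (val S) V W & comp_series W s']
  else fddim V = 0%N.

Lemma comp_series_iso V V' s : fdiso V V' -> comp_series V s -> comp_series V' s.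
Proof.
move=> iso; case: s => [|l s] /=.
  case: iso => f [g [_ fg _]] V0; apply/eqP; rewrite -leqn0 -V0.
  exact: mulmx1_min fg.
by move=> [S [W [Sl ex cW]]]; exists S, W; split=> //; exact: short_exact_iso iso ex.
Qed.

(** Peel the factors of U off V one at a time; what remains of V has W as its
    quotient throughout, until U is exhausted. *)
Lemma comp_series_cat U V W s t : short_exact U V W ->
  comp_series U s -> comp_series W t -> comp_series V (s ++ t).
Proof.
elim: s U V => [|l s IHs] U V ex /= => [U0|[S [U' [Sl exU cU']]]] cW.
  apply: comp_series_iso cW; apply: fdiso_sym.
  case: ex => f [g [[hf hg] _ gsurj e]]; apply: bij_fdiso hg _ gsurj.
  move=> u v /eqP; rewrite -subr_eq0 -mulmxBr => /eqP/e[w E].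
  by apply/eqP; rewrite -subr_eq0 E (mx_dim0 w 0 U0) mulmx0.
have [V' [exV exV']] := quotient_by_sub exU ex.
by exists S, V'; split=> //; exact: IHs exV' cU' cW.
Qed.

Lemma comp_series_irr S : comp_series (val S) [:: irr_type S].
Proof.
exists S, (fd0 A); split=> //.
apply: (@split_short_exact _ _ _ _ (fd0 A) 1%:M 0 1%:M 0).
- by move=> x; rewrite mul1mx mulmx1.
- by move=> x; rewrite mul0mx mulmx0.
- by rewrite mul0mx.
- by rewrite mul1mx.
- by apply/matrixP => -[].
- by rewrite mul1mx mul0mx addr0.
Qed.

(** A module that is neither zero nor simple has a proper nonzero submodule,
    and series of the submodule and of the quotient concatenate. *)
Lemma comp_series_exists V : exists s, comp_series V s.
Proof.
have [n] := ubnP (fddim V); elim: n V => // n IHn V; rewrite ltnS => Vn.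
have [V0|V_gt0] := posnP (fddim V); first by exists [::].
have [iV|niV] := pselect (fdirr V).
  pose S : irr_mod A := exist _ V (asboolT iV).
  by exists [:: irr_type S]; exact: (comp_series_irr S).
have [X [stX X0 XT]] : exists X : {vspace 'cV[k]_(fddim V)},
    [/\ forall x, {in X, forall v, fdact V x *m v \in X}, X <> 0%VS & X <> fullv].
  apply: contrapT => nX; apply: niV; split=> // X stX.
  have [|X0] := pselect (X = 0%VS); first by left.
  right; apply: contrapT => XT; apply: nX; by exists X.
have [U [W [ex dU]]] := stable_submodule stX; have dV := short_exact_dim ex.
have U_gt0 : (0 < fddim U)%N by rewrite dU lt0n dimv_eq0; apply/eqP.
have UV : (fddim U < fddim V)%N.
  have dT : \dim {:'cV[k]_(fddim V)} = fddim V by rewrite dimvf /dim /= muln1.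
  rewrite dU -[X in (_ < X)%N]dT ltnNge; apply/negP => E; apply: XT.
  by apply/eqP; rewrite eqEdim subvf.
have [s cs] : exists s, comp_series U s by apply: IHn; exact: leq_trans UV Vn.
have [t ct] : exists t, comp_series W t.
  by apply: IHn; apply: leq_trans Vn; rewrite dV -addn1 addnC leq_add2r.
by exists (s ++ t); exact: comp_series_cat ex cs ct.
Qed.

(** Induction on the length.  If the two series start with different simple
    submodules S and S', a series u of V/(S + S') turns into the series S' :: u of
    V/S and S :: u of V/S', and both are shorter than
    the given ones. *)
Lemma jordan_holder V s t : comp_series V s -> comp_series V t -> perm_eq s t.
Proof.
have Snil S W V' : short_exact (val S) V' W -> fddim V' <> 0%N.
  move/short_exact_dim => ->; have [S_gt0 _] := irr_mod_irr S.
  by apply/eqP; rewrite addn_eq0 -leqn0 leqNgt S_gt0.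
have [n] := ubnP (size s); elim: n V s t => // n IHn V [|l s] [|l' t] //=.
- by move=> _ V0 [S [W [_ /Snil]]].
- by move=> _ [S [W [_ /Snil]]].
rewrite ltnS => sn [S [W [<- exS cW]]] [S' [W' [<- exS' cW']]].
have [[iS iW]|[Q [exQ exQ']]] :=
  two_simple_subs (irr_mod_irr S) (irr_mod_irr S') exS exS'.
  rewrite (proj2 (irr_typeP S' S) iS) perm_cons.
  by apply: IHn cW'; [|exact: comp_series_iso cW].
have [u cu] := comp_series_exists Q.
have p1 : perm_eq s (irr_type S' :: u) by apply: (IHn W) => //; exists S', Q.
have p2 : perm_eq (irr_type S :: u) t.
  apply: (IHn W') => //; last by exists S, Q.
  by move: (perm_size p1) sn => /= ->.
apply: (@perm_trans _ [:: irr_type S, irr_type S' & u]); first by rewrite perm_cons.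
apply: (@perm_trans _ [:: irr_type S', irr_type S & u]); last by rewrite perm_cons.
by rewrite (perm_catCA [:: _] [:: _] u).
Qed.

Definition factors V : seq (Irr A) := projT1 (cid (comp_series_exists V)).

Lemma factorsP V : comp_series V (factors V).
Proof. exact: (projT2 (cid (comp_series_exists V))). Qed.

Lemma factors_exact U V W : short_exact U V W ->
  perm_eq (factors V) (factors U ++ factors W).
Proof.
move=> ex; apply: jordan_holder (factorsP V) _.
exact: comp_series_cat ex (factorsP U) (factorsP W).
Qed.

Lemma factors_irr S : factors (val S) = [:: irr_type S].
Proof.
by apply: perm_small_eq => //; exact: jordan_holder (factorsP _) (comp_series_irr S).
Qed.

End JordanHolder.

(** * Simple modules form a basis of the Grothendieck group *)

Section GrBasis.
Variables (k : fieldType) (A : kAlgType k).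
Implicit Types (U V W : fdmod A) (S : irr_mod A) (l : Irr A) (s : seq (Irr A)).

Lemma irr_classE S : irr_class (irr_type S) = gr_class (val S).
Proof.
by apply: gr_class_iso; apply/irr_typeP; rewrite /irr_type reprK.
Qed.

Lemma gr_class_series V s : comp_series V s ->
  gr_class V = \sum_(l <- s) irr_class l.
Proof.
elim: s V => [|l s IHs] V /=.
  move=> V0; rewrite big_nil -(gr_class0 A); apply: gr_class_iso.
  apply: (@bij_fdiso _ _ _ (fd0 A) 0) => [x|u v _|w].
  - by rewrite mul0mx mulmx0.
  - exact: mx_dim0 V0.
  - by exists 0; apply/matrixP => -[].
by move=> [S [W [<- /gr_class_exact -> /IHs ->]]]; rewrite big_cons irr_classE.
Qed.

Definition factor_sum V : {freeg (Irr A) / int} := \sum_(l <- factors V) << l >>.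

Lemma factor_sum_exact U V W : short_exact U V W ->
  factor_sum V = factor_sum U + factor_sum W.
Proof.
by move=> /factors_exact p; rewrite /factor_sum (perm_big _ p) big_cat.
Qed.

Lemma coeff_factor_sum V l : coeff l (factor_sum V) = (count_mem l (factors V))%:Z.
Proof.
rewrite /factor_sum; elim: (factors V) => [|l' s IHs].
  by rewrite big_nil coeff0.
by rewrite big_cons coeffD coeffU mul1r IHs /= PoszD; case: (l' == l).
Qed.

(** Well defined because composition factors are additive on short exact
    sequences; this is the map to the free group on the simple modules that inverts
    the obvious one. *)
Definition gr_coord : Gr A -> {freeg (Irr A) / int} :=
  free_lift (S := @gr_rel k A) factor_sum.

Lemma gr_coord_linear : linear (gr_coord : quot_mod (@gr_rel k A) -> _).
Proof. exact: gr_lift_linear factor_sum_exact. Qed.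

HB.instance Definition _ := GRing.isLinear.Build int (quot_mod (@gr_rel k A))
  {freeg (Irr A) / int} _ (gr_coord : quot_mod (@gr_rel k A) -> _) gr_coord_linear.

Lemma gr_coord_class V : gr_coord (gr_class V) = factor_sum V.
Proof. exact: gr_lift_class factor_sum_exact V. Qed.

End GrBasis.

Section GrBasisTheorem.
Variables (k : fieldType) (A : kAlgType k).
Implicit Types (U V W : fdmod A) (S : irr_mod A) (l : Irr A) (s : seq (Irr A)).

Let GrL := quot_mod (@gr_rel k A).
Let irrL : Irr A -> GrL := @irr_class k A.

Lemma gr_coord_irr l : gr_coord (irr_class l) = << l >>.
Proof.
rewrite -[l]reprK irr_classE gr_coord_class /factor_sum factors_irr big_seq1.
by [].
Qed.

Lemma gr_coordMz (x : Gr A) (z : int) : gr_coord (x *~ z) = gr_coord x *~ z.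
Proof. exact: (@raddfMz GrL _ (@gr_coord k A) z x). Qed.

Lemma gr_coord_sum I (r : seq I) (F : I -> Gr A) :
  gr_coord (\sum_(i <- r) F i) = \sum_(i <- r) gr_coord (F i).
Proof. exact: (@raddf_sum GrL _ (@gr_coord k A)). Qed.

(** The combination is summed over the support of D, which is not additive in D;
    written as [fglift] it visibly is. *)
Lemma gr_combE (D : {freeg (Irr A) / int}) :
  \sum_(l <- dom D) irr_class l *~ coeff l D = fglift irrL D :> GrL.
Proof.
rewrite -[D in RHS]freeg_sumE raddf_sum; apply: eq_bigr => l _.
by rewrite /= liftU -[X in _ = X *: _]intz scaler_int.
Qed.

Lemma gr_coordK (x : Gr A) :
  x = \sum_(l <- dom (gr_coord x)) irr_class l *~ coeff l (gr_coord x).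
Proof.
rewrite gr_combE; move: x; apply: (gr_ext (f := id)) => //.
  move=> x y; rewrite -[RHS](linearD (fglift irrL)); congr (fglift _ _).
  exact: (@raddfD GrL _ (@gr_coord k A)).
move=> V; rewrite gr_coord_class /factor_sum raddf_sum (gr_class_series (factorsP V)).
by apply: eq_bigr => l _; rewrite /= liftU scale1r.
Qed.

Lemma irr_class_zbasis : zbasis (@irr_class k A).
Proof.
move=> x; exists (gr_coord x); split; first exact: gr_coordK.
move=> D ->; rewrite gr_coord_sum -[RHS]freeg_sumE; apply: eq_bigr => l _.
by rewrite gr_coordMz gr_coord_irr freegU_mulz intz.
Qed.

Lemma gr_class_zplus V : zplus_comb (@irr_class k A) (gr_class V).
Proof.
exists [seq (1%N, l) | l <- factors V]; rewrite big_map.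
exact: gr_class_series (factorsP V).
Qed.

Lemma zspan_coord (J : set (Irr A)) (x : Gr A) l :
  zspan (@irr_class k A) J x -> coeff l (gr_coord x) != 0 -> J l.
Proof.
move=> [s sJ ->]; rewrite gr_coord_sum raddf_sum => nz; apply: contrapT => nJ.
case/eqP: nz; rewrite big_seq big1 // => p ps.
rewrite gr_coordMz gr_coord_irr /= raddfMz /= coeffU; case: eqP => [E|].
  by case: nJ; rewrite -E; exact: sJ.
by rewrite mulr0 mul0rz.
Qed.

(** The multiplicities of V are those of the quotient W plus those of the
    kernel, and the latter are non-negative. *)
Lemma quotient_factor V W l (g : 'M_(fddim W, fddim V)) : fdhom g ->
  (forall w : 'cV_(fddim W), exists v, w = g *m v) ->
  gr_class W = irr_class l -> coeff l (gr_coord (gr_class V)) != 0.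
Proof.
move=> hg gsurj E; have [U [f ex]] := hom_kernel hg gsurj.
rewrite gr_coord_class (factor_sum_exact (ex_intro _ f (ex_intro _ g ex))).
rewrite -(gr_coord_class W) E gr_coord_irr coeffD coeff_factor_sum coeffU eqxx.
by rewrite mulr1 -PoszD addn1.
Qed.

End GrBasisTheorem.

(** * Sweedler notation and the antipode *)

Section Tensors.
Variables (k : fieldType) (V W : lmodType k).

Lemma tens_sum_pure (t : tens V W) : exists s : seq (V * W),
  t = \sum_(p <- s) pure p.1 p.2.
Proof.
move: t; apply: free_quot_ind => [|a [x y] t [s ->]].
  by exists [::]; rewrite big_nil.
by exists ((a *: x, y) :: s); rewrite big_cons /= (linZ (pure_linearl y)).
Qed.

Lemma tens_lift_sum (U : lmodType k) (f : V -> W -> U) (s : seq (V * W)) :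
  bilin f -> tens_lift f (\sum_(p <- s) pure p.1 p.2) = \sum_(p <- s) f p.1 p.2.
Proof.
move=> bf; rewrite (lin_sum (tens_lift_linear bf)).
by apply: eq_bigr => p _; rewrite tens_liftE.
Qed.

End Tensors.

Section Sweedler.
Variables (k : fieldType) (H : hopfAlgType k).
Implicit Types (x y z : H).

(** A choice of simple tensors with sum [comul x], so that a sum over [sw x]
    renders a sum in Sweedler notation.  It is only meaningful for summands that are
    bilinear. *)
Definition sw x : seq (H * H) := projT1 (cid (tens_sum_pure (comul x))).

Lemma swE x : comul x = \sum_(p <- sw x) pure p.1 p.2.
Proof. exact: (projT2 (cid (tens_sum_pure (comul x)))). Qed.

Section Bilinear.
Variables (U : lmodType k) (f : H -> H -> U).
Hypothesis bf : bilin f.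

Lemma sw_lift x : \sum_(p <- sw x) f p.1 p.2 = tens_lift f (comul x).
Proof. by rewrite swE tens_lift_sum. Qed.

Lemma sw_sum x (s : seq (H * H)) : comul x = \sum_(p <- s) pure p.1 p.2 ->
  \sum_(p <- sw x) f p.1 p.2 = \sum_(p <- s) f p.1 p.2.
Proof. by rewrite sw_lift => ->; rewrite tens_lift_sum. Qed.

Lemma sw_linear : linear (fun x => \sum_(p <- sw x) f p.1 p.2).
Proof.
by move=> a x y; rewrite !sw_lift comul_linear tens_lift_linear.
Qed.

Lemma sw1 : \sum_(p <- sw 1) f p.1 p.2 = f 1 1.
Proof. by rewrite sw_lift comul1 tens_liftE. Qed.

Lemma swM x y : \sum_(p <- sw (x * y)) f p.1 p.2 =
  \sum_(p <- sw x) \sum_(q <- sw y) f (p.1 * q.1) (p.2 * q.2).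
Proof.
rewrite sw_lift comulM (swE x) (lin_sum (tens_mul_linearl _)).
rewrite (lin_sum (tens_lift_linear bf)); apply: eq_bigr => p _.
rewrite (swE y) (lin_sum (tens_mul_pure_linear _ _)).
rewrite (lin_sum (tens_lift_linear bf)); apply: eq_bigr => q _.
by rewrite tens_mul_pure2 tens_liftE.
Qed.
End Bilinear.

(** [comulA] tested against the trilinear map f. *)
Lemma sw_assoc (U : lmodType k) (f : H -> H -> H -> U) x :
  (forall u, bilin (f u)) -> (forall v w, linear (fun u => f u v w)) ->
  \sum_(p <- sw x) \sum_(q <- sw p.1) f q.1 q.2 p.2 =
  \sum_(p <- sw x) \sum_(q <- sw p.2) f p.1 q.1 q.2.
Proof.
move=> bf lf; pose G : tens H (tens H H) -> U := tens_lift (fun u t => tens_lift (f u) t).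
have bG : bilin (fun u (t : tens H H) => tens_lift (f u) t).
  split=> [t a u u'|u]; last exact: tens_lift_linear.
  have [s ->] := tens_sum_pure t; rewrite !tens_lift_sum //.
  by rewrite scaler_sumr -big_split; apply: eq_bigr => p _; rewrite lf.
have bp (w : H) : bilin (fun u v : H => pure u (pure v w)).
  by split=> [v|u] a y z /=; rewrite pure_linearl ?pure_linearr.
have ba : bilin (fun (t : tens H H) (w : H) => tens_lift (fun u v => pure u (pure v w)) t).
  split=> [w|t a y z]; first exact: tens_lift_linear.
  have [s ->] := tens_sum_pure t; rewrite !tens_lift_sum //.
  rewrite scaler_sumr -big_split; apply: eq_bigr => p _.
  by rewrite /= !pure_linearr.
have lG : linear G := tens_lift_linear bG.
have lc := @comul_linear k H.
have la : linear (@tens_assoc k H H H) := tens_lift_linear ba.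
transitivity (G (tens_assoc (tens_map comul id (comul x)))).
  rewrite (swE x) (lin_sum (tens_map_linear lc (@lin_id _ _))) (lin_sum la) (lin_sum lG).
  apply: eq_bigr => p _; rewrite tens_mapE //.
  rewrite [tens_assoc _](tens_liftE ba) (swE p.1) tens_lift_sum // (lin_sum lG).
  by apply: eq_bigr => q _; rewrite /G !tens_liftE.
rewrite comulA (swE x) (lin_sum (tens_map_linear (@lin_id _ _) lc)) (lin_sum lG).
apply: eq_bigr => p _; rewrite tens_mapE //.
by rewrite /G tens_liftE // -sw_lift.
Qed.

Local Notation S := (@antipode k H).

Lemma sw_counitl x : \sum_(p <- sw x) counit p.1 *: p.2 = x.
Proof.
rewrite (sw_lift (f := fun y z => counit y *: z)) ?counitl //.
split=> [z|y] a u v; first by rewrite counit_linear scalerDl scalerA.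
by rewrite scalerDr !scalerA mulrC.
Qed.

Lemma sw_counitr x : \sum_(p <- sw x) counit p.2 *: p.1 = x.
Proof.
rewrite (sw_lift (f := fun y z => counit z *: y)) ?counitr //.
split=> [z|y] a u v; last by rewrite counit_linear scalerDl scalerA.
by rewrite scalerDr !scalerA mulrC.
Qed.

Lemma sw_antipodel_bilin : bilin (fun y z : H => S y * z).
Proof.
split=> [z|y] a u v; first by rewrite antipode_linear mulrDl scalerAl.
by rewrite mulrDr scalerAr.
Qed.

Lemma sw_antipoder_bilin : bilin (fun y z : H => y * S z).
Proof.
split=> [z|y] a u v; last by rewrite antipode_linear mulrDr scalerAr.
by rewrite mulrDl scalerAl.
Qed.

Lemma sw_antipodel x : \sum_(p <- sw x) S p.1 * p.2 = counit x *: 1.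
Proof. by rewrite (sw_lift sw_antipodel_bilin) antipodel. Qed.

Lemma sw_antipoder x : \sum_(p <- sw x) p.1 * S p.2 = counit x *: 1.
Proof. by rewrite (sw_lift sw_antipoder_bilin) antipoder. Qed.

Lemma antipode1 : S 1 = 1.
Proof.
by have := sw_antipoder 1; rewrite (sw1 sw_antipoder_bilin) mul1r counit1 scale1r.
Qed.

(** Both maps x (x) y |-> S(x y) and x (x) y |-> S(y) S(x) are convolution
    inverses of the product, on the left and on the right respectively.  The sum T
    is the convolution S(x_1 y_1) (x_2 y_2) (S(y_3) S(x_3)) of all three. *)
Lemma antipodeM x y : S (x * y) = S y * S x.
Proof.
have lS := @antipode_linear k H.
pose T := \sum_(p <- sw x) \sum_(q <- sw y) \sum_(p' <- sw p.1) \sum_(q' <- sw q.1)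
  S (p'.1 * q'.1) * (p'.2 * q'.2) * (S q.2 * S p.2).
transitivity T; last first.
  rewrite -[in RHS](sw_counitl x) -[in RHS](sw_counitl y) !(lin_sum lS) mulr_sumr.
  apply: eq_bigr => p _; rewrite mulr_suml; apply: eq_bigr => q _.
  (* The first two factors of T cancel. *)
  transitivity ((counit p.1 * counit q.1) *: (S q.2 * S p.2)).
    rewrite -counitM -[S q.2 * S p.2 in RHS]mul1r scalerAl -sw_antipodel.
    rewrite (swM sw_antipodel_bilin) mulr_suml; apply: eq_bigr => p' _.
    by rewrite mulr_suml.
  by rewrite !(linZ lS) -scalerAl -scalerAr scalerA mulrC.
(* The last two factors of T cancel, y first and then x. *)
transitivity (\sum_(p <- sw x) \sum_(p' <- sw p.1) S (p'.1 * y) * p'.2 * S p.2).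
  rewrite (sw_assoc (f := fun u v w => S (u * y) * v * S w)).
  - rewrite -[in LHS](sw_counitr x) mulr_suml (lin_sum lS); apply: eq_bigr => p _.
    under [RHS]eq_bigr do rewrite -mulrA.
    by rewrite -mulr_sumr sw_antipoder -scalerAr mulr1 -scalerAl (linZ lS).
  - move=> u; split=> [w|v] a z z'.
      by rewrite mulrDr mulrDl -scalerAr -scalerAl.
    by rewrite lS mulrDr -scalerAr.
  - by move=> v w a z z'; rewrite mulrDl -scalerAl lS !mulrDl -!scalerAl.
apply: eq_bigr => p _; rewrite exchange_big; apply: eq_bigr => p' _ /=.
rewrite (sw_assoc (f := fun u v w => S (p'.1 * u) * (p'.2 * v) * (S w * S p.2))).
- rewrite -{1}(sw_counitr y) mulr_sumr (lin_sum lS) !mulr_suml; apply: eq_bigr => q _.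
  transitivity (\sum_(q' <- sw q.2)
      S (p'.1 * q.1) * p'.2 * (q'.1 * S q'.2) * S p.2); last first.
    by apply: eq_bigr => q' _; rewrite !mulrA.
  rewrite -mulr_suml -mulr_sumr sw_antipoder -!scalerAr mulr1 (linZ lS).
  by rewrite -!scalerAl.
- move=> u; split=> [w|v] a z z'.
    by rewrite !mulrDr mulrDl -!scalerAr -scalerAl.
  by rewrite lS mulrDl mulrDr -scalerAl -scalerAr.
- by move=> v w a z z'; rewrite mulrDr -scalerAr lS !mulrDl -!scalerAl.
Qed.

End Sweedler.

(** * Representations of a fiber as representations of H *)

Section FiberRep.
Variables (k : fieldType) (H : hopfAlgType k) (C : central_hopf_subalg H).
Variable m : maxSpec C.

(* A representation of H that kills m factors through H/mH. *)
Section Descent.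
Variables (n : nat) (r : H -> 'M[k]_n).
Hypotheses (r_lin : linear r) (r1 : r 1 = 1%:M).
Hypothesis rM : forall x y, r (x * y) = r x *m r y.
Hypothesis r_kill : forall c, m c -> r c = 0.

Definition fiber_act (x : fiber m) : 'M[k]_n := r (repr (x : quot_mod (ideal_gen m))).

Lemma fiber_actE h : fiber_act (fproj m h) = r h.
Proof.
have ker x : x \in lin_span (ideal_gen m) -> r x = 0.
  elim/lin_span_min=> [|a v w Ev Ew|_ [c [y [mc ->]]]]; first exact: lin0.
    by rewrite r_lin Ev Ew scaler0 addr0.
  by rewrite rM r_kill ?mul0mx.
apply/eqP; rewrite -subr_eq0 /fiber_act -scaleN1r addrC -r_lin.
rewrite addrC scaleN1r; apply/eqP/ker.
by rewrite -fproj_eq /fproj repr_qproj.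
Qed.

Fact fiber_act_zmod : zmod_morphism fiber_act.
Proof.
move=> x y; have [{}x ->] := fproj_surj x; have [{}y ->] := fproj_surj y.
by rewrite -scaleN1r addrC -fproj_linear !fiber_actE r_lin scaleN1r addrC.
Qed.

Fact fiber_act_monoid : monoid_morphism fiber_act.
Proof.
split=> [|x y]; first by rewrite -[1]/(fproj m 1) fiber_actE.
have [{}x ->] := fproj_surj x; have [{}y ->] := fproj_surj y.
by rewrite -fprojM !fiber_actE.
Qed.

Fact fiber_act_kmap a : fiber_act (kmap a) = a%:M.
Proof.
by rewrite -[kmap a]/(fproj m a%:A) fiber_actE (linZ r_lin) r1 scalemx1.
Qed.

Definition fiber_rep : fdmod (fiber m) :=
  FdMod fiber_act_zmod fiber_act_monoid fiber_act_kmap.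
End Descent.

Definition hact (V : fdmod (fiber m)) (h : H) := fdact V (fproj m h).

Variable V : fdmod (fiber m).

Lemma hact_linear : linear (hact V).
Proof. exact: lin_comp (@fdact_linear _ _ _ _ V) (@fproj_linear _ _ _ m). Qed.

Lemma hact1 : hact V 1 = 1%:M.
Proof. exact: (fdact_monoid V).1. Qed.

Lemma hactM x y : hact V (x * y) = hact V x *m hact V y.
Proof. by rewrite /hact fprojM (fdact_monoid V).2. Qed.

Lemma hact_kill c : m c -> hact V c = 0.
Proof.
by move=> mc; rewrite /hact -[c]mulr1 fproj_kill // (lin0 (@fdact_linear _ _ _ _ V)).
Qed.

End FiberRep.

(** * The action of C on modules over a fiber *)

Section CentralCharacter.
Variables (k : closedFieldType) (H : hopfAlgType k) (C : central_hopf_subalg H).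
Variable m : maxSpec C.

Lemma singular_shift n (M : 'M[k]_n) : (0 < n)%N ->
  exists a, M - a%:M \notin unitmx.
Proof.
case: n M => // n M _; have [|a] := elimT (closed_rootP (char_poly M)).
  by rewrite size_char_poly.
rewrite -eigenvalue_root_char => /eigenvalueP[v vM v0]; exists a.
apply/negP => u; case/eqP: v0; rewrite -[v](mulmxK u) mulmxBr vM mul_mx_scalar.
by rewrite subrr mul0mx.
Qed.

(** Let a be an eigenvalue of c on V.  An identity 1 = y + c' (c - a) with y in m
    would make c - a invertible on V, where y acts as zero; so m + C (c - a) is a
    proper ideal, equal to m by maximality. *)
Lemma residue_field (V : fdmod (fiber m)) c : (0 < fddim V)%N -> C c ->
  exists a : k, m (c - a *: 1).
Proof.
move=> V_gt0 Cc; have [a sing] := singular_shift (hact V c) V_gt0; exists a.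
have C1 := csub1 C; have [mC m0 mD mM] := mideal_ideal m.
have Cca : C (c - a *: 1).
  by rewrite addrC -scaleNr; apply: csubL.
apply: (@mideal_max _ _ _ m (fun x =>
  exists y c', [/\ m y, C c' & x = y + c' * (c - a *: 1)])).
- split.
  + move=> x [y [c' [my Cc' ->]]]; rewrite -[y]scale1r; apply: csubL; first exact: mC.
    exact: csubM.
  + by exists 0, 0; split=> //; [exact: csub0 | rewrite mul0r addr0].
  + move=> _ _ [y [c' [my Cc' ->]]] [z [d [mz Cd ->]]].
    exists (y + z), (c' + d); split; first exact: mD.
      by rewrite -[c']scale1r; apply: csubL.
    by rewrite mulrDl addrACA.
  + move=> d _ Cd [y [c' [my Cc' ->]]]; exists (d * y), (d * c'); split.
    * exact: mM.
    * exact: csubM.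
    * by rewrite mulrDr mulrA.
- by move=> x mx; exists x, 0; split=> //; [exact: csub0 | rewrite mul0r addr0].
- move=> [y [c' [my Cc' /(congr1 (hact V))]]].
  have lV := hact_linear V.
  rewrite (linD lV) (hact_kill V my) add0r hactM hact1 => E.
  have caE : hact V (c - a *: 1) = hact V c - a%:M.
    by rewrite addrC -scaleNr lV hact1 scaleNr scalemx1 addrC.
  by case/negP: sing; move/esym: E; rewrite caE => /mulmx1_unit[].
by exists 0, 1; split=> //; rewrite mul1r add0r.
Qed.

End CentralCharacter.

(** * The internal Hom and its evaluation map *)

Lemma tensmx_scalar (k : fieldType) n p (a b : k) :
  a%:M *t b%:M = (a * b)%:M :> 'M_(n * p).
Proof.
have [tl tr] := tensmx_bilin k n n p p.
rewrite -(scalemx1 n a) -(scalemx1 p b) (linZ (tl _)) (linZ (tr _)) tens1mx1.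
by rewrite scalerA scalemx1.
Qed.

Section InternalHom.
Variables (k : closedFieldType) (H : hopfAlgType k) (C : central_hopf_subalg H).
Variable m : maxSpec C.
Variables V W : fdmod (fiber m).

Let homf (x y : H) : 'M[k]_(fddim W * fddim V) :=
  hact W x *t (hact V (antipode y))^T.

Lemma homf_bilin : bilin homf.
Proof.
have [tl tr] := tensmx_bilin k (fddim W) (fddim W) (fddim V) (fddim V).
split=> [y|x] a u v; rewrite /homf; first by rewrite hact_linear tl.
by rewrite antipode_linear hact_linear linearP tr.
Qed.

(** The action on the linear maps from V to W, seen as W (x) V^* : transposing
    gives a right action of H on V^*, which the antipode turns into a left one. *)
Definition hom_act (h : H) : 'M[k]_(fddim W * fddim V) :=
  \sum_(p <- sw h) homf p.1 p.2.

Lemma hom_act_linear : linear hom_act.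
Proof. exact: sw_linear homf_bilin. Qed.

Lemma hom_act1 : hom_act 1 = 1%:M.
Proof.
rewrite /hom_act (sw1 homf_bilin) /homf antipode1 !hact1 trmx1; exact: tens1mx1.
Qed.

Lemma hom_actM x y : hom_act (x * y) = hom_act x *m hom_act y.
Proof.
rewrite /hom_act (swM homf_bilin) mulmx_suml; apply: eq_bigr => p _.
rewrite mulmx_sumr; apply: eq_bigr => q _.
by rewrite /homf tensmx_mul -trmx_mul antipodeM !hactM.
Qed.

Hypothesis V_gt0 : (0 < fddim V)%N.

(** C acts on V and on W through the same character chi, so c acts on W (x) V^*
    by chi(c_1) chi(S c_2), which is also how c_1 S(c_2) = counit c acts on V. *)
Lemma hom_act_counit c : C c -> hom_act c = (counit c)%:M.
Proof.
have chiP c' : exists a : k, C c' -> m (c' - a *: 1).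
  have [Cc'|] := pselect (C c'); last by exists 0.
  by have [a ma] := residue_field V_gt0 Cc'; exists a.
have [chi mchi] := choice chiP.
have actC (U : fdmod (fiber m)) d : C d -> hact U d = (chi d)%:M.
  move=> Cd; apply/eqP; rewrite -subr_eq0 -scalemx1 -(hact1 U) -scaleN1r.
  have lU := hact_linear U.
  rewrite -(linZ lU) addrC -lU scaleN1r addrC; apply/eqP/hact_kill; exact: mchi.
move=> Cc; have [s sC Es] := csub_comul Cc.
rewrite /hom_act (sw_sum homf_bilin Es).
pose b (p : H * H) := chi p.1 * chi (antipode p.2).
transitivity (\sum_(p <- s) (b p)%:M : 'M[k]_(fddim W * fddim V)).
  rewrite big_seq [RHS]big_seq; apply: eq_bigr => p ps; have [C1 C2] := sC p ps.
  rewrite /homf (actC W _ C1) (actC V _ (csub_antipode C2)) tr_scalar_mx.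
  exact: tensmx_scalar.
rewrite -raddf_sum; congr _%:M.
(* Scalars are compared through their action on V, which is nonzero. *)
have E : (\sum_(p <- s) b p)%:M = (counit c)%:M :> 'M_(fddim V).
  have <- : hact V (counit c *: 1) = (counit c)%:M.
    by rewrite (linZ (hact_linear V)) hact1 scalemx1.
  rewrite -sw_antipoder (sw_sum (@sw_antipoder_bilin k H) Es).
  rewrite (lin_sum (hact_linear V)) raddf_sum big_seq [RHS]big_seq.
  apply: eq_bigr => p ps; have [C1 C2] := sC p ps.
  by rewrite hactM (actC V _ C1) (actC V _ (csub_antipode C2)) -scalar_mxM.
have := congr1 (fun M : 'M_(fddim V) => M (Ordinal V_gt0) (Ordinal V_gt0)) E.
by rewrite !mxE eqxx !mulr1n.
Qed.

Lemma hom_act_kill c : counit_max C c -> hom_act c = 0.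
Proof. by case=> Cc c0; rewrite hom_act_counit // c0 raddf0. Qed.

Definition hom_mod : fdmod (fiber (counit_max C)) :=
  fiber_rep hom_act_linear hom_act1 hom_actM hom_act_kill.

(** The evaluation map (W (x) V^* ) (x) V -> W, sending the basis element
    e_j (x) e_b^* (x) e_c to e_j if b = c and to 0 otherwise. *)
Definition eval_mx : 'M[k]_(fddim W, (fddim W * fddim V) * fddim V) :=
  \matrix_(i, l) let (jb, c) := mxtens_unindex l in
    let (j, b) := mxtens_unindex jb in ((i == j) && (b == c))%:R.

Lemma eval_mxE i j b c :
  eval_mx i (mxtens_index (mxtens_index (j, b), c)) = ((i == j) && (b == c))%:R.
Proof. by rewrite mxE !mxtens_indexK. Qed.

Lemma sum_mxtens p q (F : 'I_(p * q) -> k) :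
  \sum_l F l = \sum_i \sum_j F (mxtens_index (i, j)).
Proof.
rewrite pair_big (reindex (@mxtens_index p q)) /=; first by apply: eq_bigr => -[].
by exists (@mxtens_unindex p q) => l _; rewrite (mxtens_indexK, mxtens_unindexK).
Qed.

Lemma eval_mulE (M : 'M_(fddim W)) (N P : 'M_(fddim V)) i j b c :
  (eval_mx *m (M *t N^T *t P)) i (mxtens_index (mxtens_index (j, b), c)) =
  M i j * (N *m P) b c.
Proof.
rewrite mxE sum_mxtens sum_mxtens (bigD1 i) //= [X in _ + X]big1 ?addr0; last first.
  move=> i' /negPf ni; rewrite big1 // => b' _; rewrite big1 // => c' _.
  by rewrite eval_mxE eq_sym ni mul0r.
rewrite !mxE mulr_sumr; apply: eq_bigr => b' _.
rewrite (bigD1 b') //= [X in _ + X]big1 ?addr0; last first.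
  by move=> c' /negPf nc; rewrite eval_mxE [b' == _]eq_sym nc andbF mul0r.
by rewrite eval_mxE !eqxx mul1r !tensmxE mxE mulrA.
Qed.

(** For f in V^* and v in V, the element h sends w (x) f (x) v to the tensor
    h_1 w (x) f(S(h_2) -) (x) h_3 v, whose evaluation is
    f(S(h_2) h_3 v) h_1 w = f(v) h w. *)
Lemma eval_hom : @fdhom _ _ (tens_mod hom_mod V) W eval_mx.
Proof.
move=> x; have [h ->] := fproj_surj x; rewrite /= tens_actE.
rewrite -(sw_lift (hact_bilin hom_mod V)).
have -> : \sum_(p <- sw h) fdact hom_mod (fproj _ p.1) *t fdact V (fproj m p.2) =
    \sum_(p <- sw h) hom_act p.1 *t hact V p.2.
  apply: eq_bigr => p _.
  by rewrite -(fiber_actE hom_act_linear hom_actM hom_act_kill p.1).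
apply/matrixP => i l; case: (mxtens_indexP l) => jb c; case: (mxtens_indexP jb) => j b.
rewrite -/(hact W h) mulmx_sumr summxE.
transitivity (\sum_(p <- sw h) \sum_(q <- sw p.1)
    hact W q.1 i j * (hact V (antipode q.2) *m hact V p.2) b c).
  apply: eq_bigr => p _; rewrite /hom_act.
  have [tl _] := tensmx_bilin k (fddim W * fddim V) (fddim W * fddim V) (fddim V) (fddim V).
  rewrite (lin_sum (tl _)) mulmx_sumr summxE; apply: eq_bigr => q _.
  by rewrite eval_mulE.
pose f u v w : k^o := hact W u i j * hact V (antipode v * w) b c.
transitivity (\sum_(p <- sw h) \sum_(q <- sw p.1) f q.1 q.2 p.2).
  by apply: eq_bigr => p _; apply: eq_bigr => q _; rewrite /f hactM.
have lW := hact_linear W; have lV := hact_linear V.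
rewrite sw_assoc; last 2 first.
- move=> u; split=> [w|v] a z z'; rewrite /f.
    by rewrite (sw_antipodel_bilin H).1 lV !mxE mulrDr mulrCA.
  by rewrite (sw_antipodel_bilin H).2 lV !mxE mulrDr mulrCA.
- by move=> v w a z z'; rewrite /f lW !mxE mulrDl -mulrA.
transitivity (hact W h i j * (b == c)%:R).
  rewrite -{2}(sw_counitr h) (lin_sum lW) summxE mulr_suml; apply: eq_bigr => p _.
  rewrite -mulr_sumr -summxE -(lin_sum lV) sw_antipodel (linZ lV) hact1.
  by rewrite (linZ lW) !mxE mulrCA mulrA.
rewrite mxE (bigD1 j) //= big1 ?addr0 => [|j' /negPf nj].
  by rewrite eval_mxE eqxx.
by rewrite eval_mxE nj mulr0.
Qed.

(** A preimage of w is w (x) e_0^* (x) e_0. *)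
Lemma eval_surj (w : 'cV_(fddim W)) : exists v, w = eval_mx *m v.
Proof.
pose b0 := Ordinal V_gt0.
pose v : 'cV_((fddim W * fddim V) * fddim V) :=
  \col_l let (jb, c) := mxtens_unindex l in
    let (j, b) := mxtens_unindex jb in w j 0 *+ ((b == b0) && (c == b0)).
have vE j b c : v (mxtens_index (mxtens_index (j, b), c)) 0 =
    w j 0 *+ ((b == b0) && (c == b0)).
  by rewrite mxE !mxtens_indexK.
exists v; apply/matrixP => i z; rewrite ord1 mxE sum_mxtens sum_mxtens.
rewrite (bigD1 i) //= [X in _ + X]big1 ?addr0; last first.
  move=> i' /negPf ni; rewrite big1 // => b' _; rewrite big1 // => c' _.
  by rewrite eval_mxE eq_sym ni mul0r.
rewrite (bigD1 b0) //= [X in _ + X]big1 ?addr0; last first.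
  move=> b' /negPf nb; rewrite big1 // => c' _.
  by rewrite vE nb mulr0.
rewrite (bigD1 b0) //= [X in _ + X]big1 ?addr0; last first.
  by move=> c' /negPf nc; rewrite vE nc andbF mulr0.
by rewrite vE eval_mxE !eqxx mul1r.
Qed.

End InternalHom.

Theorem corollary2p9 (k : closedFieldType) (H : hopfAlgType k)
    (C : central_hopf_subalg H)
    (H_affine : affine H) (H_finite : module_finite C) (m : maxSpec C) :
  irreducible_zplus_module (gr_ring_basis C) (gr_module_basis m).
Proof.
split.
- split; first exact: irr_class_zbasis.
  by move=> i j; rewrite /GRing.mul /= gr_mulE; exact: gr_class_zplus.
- split; first exact: irr_class_zbasis.
  by move=> i j; rewrite /GRing.scale /= gr_mulE; exact: gr_class_zplus.
move=> J stJ; have [[l0 Jl0]|nJ] := pselect (exists l, J l); last first.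
  by left; apply/seteqP; split=> // l Jl; case: nJ; exists l.
right; apply/seteqP; split=> // l _.
pose rep (i : Irr (fiber m)) := repr (i : {eq_quot (@irr_iso k (fiber m))}).
pose V := val (rep l0); pose W := val (rep l).
have V_gt0 : (0 < fddim V)%N by have [] := irr_mod_irr (rep l0).
have := stJ (gr_class (hom_mod W V_gt0)) (irr_class l0).
rewrite [_ *: _]gr_mulE => /(_ _)/zspan_coord; apply.
  exists [:: (1, l0)]; last by rewrite big_seq1.
  by move=> p; rewrite inE => /eqP ->.
exact: quotient_factor (@eval_hom _ _ _ _ V W V_gt0) (eval_surj V_gt0) _.
Qed.
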